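(* Let $n\ge1$. The estimate $$\|U(t)f\|_{L^{q,\infty}_tL^r_xL^p_v}\lesssim\|f\|_{L^b_xL^c_v}$$ holds for all $f\in L^b_xL^c_v$ in each of the following cases: (a) $1<q<\infty$, $1\le p,r<\infty$, and $$\frac1q+\frac nr=\frac nb,\quad\mathrm{HM}(p,r)=\mathrm{HM}(b,c)=:a,\quad p<b\le a\le c<r,\quad a\le r<r^*(c);$$ (b) $b=c=p=r$ with $0<b\le\infty$, and $q=\infty$; (c) $b=p$, $c=r$, $1\le p\le r\le\infty$, and $\frac1q=\frac np-\frac nr$.
   Context: $U(t)f(x,v)=f(x-tv,v)$ for $f$ on $\mathbb R^n\times\mathbb R^n$. $L^{q,\infty}_tL^r_xL^p_v$ is the weak-$L^q$ (Lorentz $L^{q,\infty}$) space in $t\in\mathbb R$ with values in $L^r(\mathbb R^n;L^p(\mathbb R^n))$ ($L^{\infty,\infty}=L^\infty$); $L^b_xL^c_v=L^b(\mathbb R^n;L^c(\mathbb R^n))$. $\mathrm{HM}(p,r)$ is the harmonic mean: $\frac1{\mathrm{HM}(p,r)}=\frac12\left(\frac1p+\frac1r\right)$. $1/\infty=0$, $1/0=\infty$. For $1\le c\le\infty$: $r^*(c)=\frac{nc}{n-1}$ if $c\ge\frac{n+1}n$ and $r^*(c)=\frac c{2-c}$ if $1\le c\le\frac{n+1}n$ (so for $n=1$, $r^*(c)=\infty$ for $c\ge2$). $\lesssim$ means $\le$ up to a constant independent of $f$. *)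

(* Defs.v *)
From HB Require Import structures.
From mathcomp Require Import all_boot all_order all_algebra.
From mathcomp Require Import all_classical all_reals all_analysis.

Set Implicit Arguments.
Unset Strict Implicit.
Unset Printing Implicit Defensive.
Import Order.TTheory GRing.Theory Num.Theory.
Import numFieldNormedType.Exports.

Local Open Scope classical_set_scope.
Local Open Scope ring_scope.

(* R^n as n-tuples with the product sigma-algebra of the Borel sets of R,
   i.e., the Borel sets of R^n. *)
Notation Rn R n := (n.-tuple (measurableTypeR R)).

Section lebesgue_Rn.
Local Open Scope ereal_scope.
Context {R : realType}.
Local Notation lambda := (@lebesgue_measure R).

Definition cons_Rn n (z : measurableTypeR R * Rn R n) : Rn R n.+1 :=
  [tuple of z.1 :: z.2].

Lemma measurable_cons_Rn n : measurable_fun setT (@cons_Rn n).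
Proof. exact: (measurable_cons measurable_fst measurable_snd). Qed.

Lemma measurable_preimage_cons_Rn n (A : set (Rn R n.+1)) :
  measurable A -> measurable (@cons_Rn n @^-1` A).
Proof.
by move=> mA; rewrite -[X in measurable X]setTI; exact: measurable_cons_Rn.
Qed.

Section step.
Variables (n : nat) (mu : {sigma_finite_measure set (Rn R n) -> \bar R}).

(* Product of the Lebesgue measure of R with mu, transported along the
   identification of R * R^n with R^(n+1). *)
Definition lebesgue_cons : set (Rn R n.+1) -> \bar R :=
  pushforward (lambda \x mu) (@cons_Rn n).

Let lebesgue_cons0 : lebesgue_cons set0 = 0.
Proof. by rewrite /lebesgue_cons /pushforward preimage_set0 measure0. Qed.

Let lebesgue_cons_ge0 A : 0 <= lebesgue_cons A.
Proof. exact: (measure_ge0 (lambda \x mu)). Qed.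

Let lebesgue_cons_sigma_additive : semi_sigma_additive lebesgue_cons.
Proof.
move=> F mF tF mUF; rewrite /lebesgue_cons /pushforward preimage_bigcup.
apply: measure_semi_sigma_additive.
- by move=> i; exact: measurable_preimage_cons_Rn.
- apply/trivIsetP => /= i j _ _ ij; rewrite -preimage_setI.
  by move/trivIsetP : tF => /(_ _ _ _ _ ij) ->//; rewrite preimage_set0.
- by rewrite -preimage_bigcup; exact: measurable_preimage_cons_Rn.
Qed.

HB.instance Definition _ := isMeasure.Build _ _ _ lebesgue_cons
  lebesgue_cons0 lebesgue_cons_ge0 lebesgue_cons_sigma_additive.

Let lebesgue_cons_sigma_finite : sigma_finite setT lebesgue_cons.
Proof.
have /sigma_finiteP[F [TF ndF Foo]] := sigma_finiteT lambda.
have /sigma_finiteP[G [TG ndG Goo]] := sigma_finiteT mu.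
exists (fun k => [set x | F k (thead x) /\ G k [tuple of behead x]]).
  apply/esym; rewrite -subTset => x _.
  have [i _ Fix] : (\bigcup_i F i) (thead x) by rewrite -TF.
  have [j _ Gjx] : (\bigcup_i G i) [tuple of behead x] by rewrite -TG.
  exists (maxn i j) => //; split.
  - by move: Fix; exact/subsetPset/ndF/leq_maxl.
  - by move: Gjx; exact/subsetPset/ndG/leq_maxr.
move=> k; have [mF Fk] := Foo k; have [mG Gk] := Goo k; split.
  apply: measurableI; rewrite -[X in measurable X]setTI.
  - exact: (measurable_tnth ord0).
  - exact: measurable_behead.
rewrite /lebesgue_cons /pushforward.
rewrite (_ : _ @^-1` _ = F k `*` G k).
  by rewrite product_measure1E// lte_mul_pinfty// ge0_fin_numE.
by apply/seteqP; split=> -[x y] /= [Fx Gy]; split; [move: Fx|move: Gy|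
  move: Fx|move: Gy]; rewrite /thead ?(tnth_nth x)//=; congr (G k _);
  exact: val_inj.
Qed.

HB.instance Definition _ := Measure_isSigmaFinite.Build _ _ _ lebesgue_cons
  lebesgue_cons_sigma_finite.

End step.

Fixpoint lebesgue_Rn n : {sigma_finite_measure set (Rn R n) -> \bar R} :=
  match n with
  | 0%N => @dirac _ (Rn R 0) [tuple] R
  | m.+1 => lebesgue_cons (lebesgue_Rn m)
  end.

Lemma lebesgue_Rn_box n (A : 'I_n -> set (measurableTypeR R)) :
  (forall i, measurable (A i)) ->
  lebesgue_Rn n [set x | forall i, A i (tnth x i)] =
  \big[mule/1]_(i < n) lambda (A i).
Proof.
elim: n A => [|n IHn] A mA.
  by rewrite big_ord0 /= diracE (_ : _ \in _)//; apply/mem_set => -[].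
rewrite big_ord_recl -IHn//=.
rewrite /lebesgue_cons /pushforward.
rewrite (_ : _ @^-1` _ =
    A ord0 `*` [set y : Rn R n | forall i, A (lift ord0 i) (tnth y i)]).
  rewrite product_measure1E//.
  rewrite (_ : [set y | _] = \bigcap_(i in [set: 'I_n])
      ((@tnth n (measurableTypeR R))^~ i @^-1` A (lift ord0 i))).
    apply: fin_bigcap_measurable => // i _.
    by rewrite -[X in measurable X]setTI; exact: measurable_tnth.
  by apply/seteqP; split=> y /= yA i; [move=> _; exact: yA|exact: (yA i I)].
apply/seteqP; split=> [[x y] /= xyA|[x y] /= [xA yA] i].
  split; first exact: (xyA ord0).
  by move=> i; have := xyA (lift ord0 i); rewrite tnthS.
by have [j ->|->] := unliftP ord0 i; [rewrite tnthS; exact: yA|exact: xA].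
Qed.

End lebesgue_Rn.

Section kinetic_transport.
Context {R : realType}.
Local Open Scope ereal_scope.

Definition transport n (t : R) (f : Rn R n * Rn R n -> R) :
    Rn R n * Rn R n -> R :=
  fun z => f ([tuple (tnth z.1 i - t * tnth z.2 i)%R | i < n], z.2).

Definition mixed_norm n (b c : \bar R) (f : Rn R n * Rn R n -> R) : \bar R :=
  Lnorm (lebesgue_Rn n) b
    (fun x => Lnorm (lebesgue_Rn n) c (fun v => (f (x, v))%:E)).

(* Mixed Lebesgue space, with Borel measurable representatives. *)
Definition mixed_Lebesgue n (b c : \bar R) : set (Rn R n * Rn R n -> R) :=
  [set f | measurable_fun setT f /\ mixed_norm b c f < +oo].

(* Quasi-norm of the Lorentz space L^(q,oo) for 0 < q <= oo; the value in the
   last branch is irrelevant. *)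
Definition weak_norm d (T : measurableType d)
    (mu : {measure set T -> \bar R}) (q : \bar R) (g : T -> \bar R) : \bar R :=
  match q with
  | q'%:E => ereal_sup [set s%:E * mu [set t | s%:E < `|g t|] `^ q'^-1
                       | s in [set s : R | (0 < s)%R]]
  | +oo => Lnorm mu +oo g
  | -oo => 0
  end.

Definition HM (p r : \bar R) : \bar R := (2^-1%:E * (p^-1 + r^-1))^-1.

(* Both divisions are in the extended reals, where a / 0 = +oo for a > 0. *)
Definition rstar (n : nat) (c : \bar R) : \bar R :=
  if (n.+1%:R / n%:R)%:E <= c then n%:R%:E * c / n.-1%:R%:E
  else c / (2%:E - c).

End kinetic_transport.

(* Main.v *)
(* Replacing f by F = |f|^p reduces everything to p = 1, that is, to the velocity
averages rho_F(t, x) = \int F(x - t v, v) dv.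

Dispersion. The change of variables v |-> x - t v gives
\int M(x - t v) dv = |t|^-n \int M for every M >= 0.

Interpolation. Averaging is a positive operator, so Hoelder's inequality replaces
complex interpolation: with M(x) the b-th power of the norm of F(x, .) in L^c and
th = 1 + 1/c - 1/b, write F = M^(1 - th) H^th, so that H is in L^(th c) of phase
space and rho_F <= (|t|^-n \int M)^(1 - th) rho_H^th. In case (c) we have th c = 1
and rho_H is controlled by conservation of mass (for r = oo dispersion alone is
enough). In case (a) the hypotheses p < b and r < r*(c) give 1 < a < (n + 1)/n for
a = th c, and rho_H is controlled by the Strichartz estimate on L^a.

Strichartz estimate, in weak form. Let r = a/(2 - a), S(t) = \int rho_H(t, .)^r and
E = {S > sigma}. A T T^* argument with phi_t = rho_H(t, .)^(r - 1) and the bound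
\int\int H^(2-a) phi_t(x + t v) phi_s(x + s v) <= |t - s|^(-n(a-1)) (S(t) S(s))^(a/2),
which is Hoelder's inequality followed by the change of variables
(x, v) |-> (x + t v, x + s v), gives
\int_E S^(1 - a/2) <= ||H||_a^(a/2) (\int_E \int_E |t - s|^(-n(a-1)))^(1/2), and the
last double integral is at most C |E|^(2 - n(a-1)). *)
From HB Require Import structures.
Require Import Defs.
From mathcomp Require Import all_boot all_order all_algebra.
From mathcomp Require Import all_classical all_reals all_analysis.
From mathcomp Require Import measurable_realfun ess_sup_inf ring lra.

Set Implicit Arguments.
Unset Strict Implicit.
Unset Printing Implicit Defensive.
Import Order.TTheory GRing.Theory Num.Theory.
Import numFieldNormedType.Exports.

Local Open Scope classical_set_scope.
Local Open Scope ring_scope.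
Local Open Scope ereal_scope.

(** The overview leaves out how its two bounds are combined. The interpolated bound carries a power
    of [|t|^-n], which blows up at t = 0, and the weak Strichartz bound only counts times. No
    product estimate in Lorentz spaces is used: at each level sigma the times are cut at some tau.
    The times |t| <= tau cost at most 2 tau; for |t| > tau the singular factor is at most its value
    at tau, and the Strichartz bound applies at the modified level. Choosing tau so that both costs
    have the same size gives the weak bound. Two difficulties shape the rest. The T T^* argument
    divides by powers of S(t) and finally by a power of |E|, so both must be finite and positive: H
    is truncated and E is cut to |t| <= k, with constants independent of k, and monotone limits
    remove the cuts. The interpolation divides by a power of M, which may vanish: M is raised to a
    positive function at the cost of e in its integral, and e disappears only when the weak norm is
    assembled. *)

(** * Affine changes of variables in R^n *)

Section affine_change_of_variables.
Context {R : realType}.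
Local Notation lambda := (@lebesgue_measure R).

(** Uniqueness of Lebesgue measure: the pushforward scaled by [|a|] is a measure that gives every
    interval []c, d]] its length. *)
Lemma lebesgue_measure_affine (a y : R) (A : set R) : a != 0%R ->
  measurable A ->
  lambda ((fun z => y + a * z)%R @^-1` A) = `|a|^-1%:E * lambda A.
Proof.
move=> a0 mA.
have mphi : measurable_fun setT (fun z : measurableTypeR R =>
    (y + a * z)%R : measurableTypeR R).
  by apply: measurable_funD => //; exact: measurable_funM.
have an0 : (`|a| != 0)%R by rewrite normr_eq0.
suff lm : forall X, measurable X -> lambda X = `|a|%:E *
    lambda ((fun z => y + a * z)%R @^-1` X).
  by rewrite [in RHS]lm// muleA -EFinM mulVf// mul1e.
pose m' : {measure set (measurableTypeR R) -> \bar R} :=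
  @mscale _ _ _ (NngNum (normr_ge0 a)) (pushforward lambda
    (fun z : measurableTypeR R => (y + a * z)%R : measurableTypeR R)).
move=> X mX; rewrite (@lebesgue_measure_unique R (m' mphi))//=.
move=> _ [[c d]] _ <-; rewrite /m' /mscale/= /pushforward/=.
rewrite lebesgue_measure_itv/=.
case: (ltgtP a 0%R) a0 => // a_0 _.
(* For negative [a] the preimage is closed on the left and open on the right, which leaves its
   length unchanged. *)
- have -> : (fun z => y + a * z)%R @^-1` `]c, d]%classic =
      `[(d - y) / a, (c - y) / a[%classic%R.
    apply/seteqP; split => z /=; rewrite !in_itv/=.
      by move=> /andP[h1 h2]; rewrite ler_ndivrMr// ltr_ndivlMr//; apply/andP; lra.
    by rewrite ler_ndivrMr// ltr_ndivlMr// => /andP[h1 h2]; apply/andP; lra.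
  rewrite lebesgue_measure_itv/= !lte_fin.
  rewrite ltr_ndivrMr// mulfVK ?lt_eqF//; rewrite ltrD2r.
  case: ifPn => // _; last by rewrite mule0.
  by rewrite -!EFinB -EFinM ltr0_norm//; congr EFin; field; rewrite lt_eqF.
- have -> : (fun z => y + a * z)%R @^-1` `]c, d]%classic =
      `](c - y) / a, (d - y) / a]%classic%R.
    apply/seteqP; split => z /=; rewrite !in_itv/=.
      by move=> /andP[h1 h2]; rewrite ltr_pdivrMr// ler_pdivlMr//; apply/andP; lra.
    by rewrite ltr_pdivrMr// ler_pdivlMr// => /andP[h1 h2]; apply/andP; lra.
  rewrite lebesgue_measure_itv/= !lte_fin.
  rewrite ltr_pdivrMr// mulfVK ?gt_eqF//; rewrite ltrD2r.
  case: ifPn => // _; last by rewrite mule0.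
  by rewrite -!EFinB -EFinM gtr0_norm//; congr EFin; field; rewrite gt_eqF.
Qed.

Lemma ge0_integral_affine (a y : R) (phi : measurableTypeR R -> \bar R) :
  a != 0%R -> measurable_fun setT phi -> (forall z, 0 <= phi z) ->
  \int[lambda]_z phi (y + a * z)%R = `|a|^-1%:E * \int[lambda]_z phi z.
Proof.
move=> a0 mphi phi0.
have mg : measurable_fun setT (fun z : measurableTypeR R =>
    (y + a * z)%R : measurableTypeR R).
  by apply: measurable_funD => //; exact: measurable_funM.
have ai0 : (0 <= `|a|^-1)%R by rewrite invr_ge0.
rewrite -(@ge0_integral_mscale _ _ _ lambda setT measurableT (NngNum ai0))//.
rewrite -(ge0_integral_pushforward mg lambda measurableT mphi)//.
apply: eq_measure_integral => A mA _ /=.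
by rewrite /pushforward/= lebesgue_measure_affine.
Qed.

Lemma integral_Rn0 (phi : Rn R 0 -> \bar R) :
  \int[lebesgue_Rn 0]_x phi x = phi [tuple].
Proof.
have -> : phi = cst (phi [tuple]).
  by apply/funext => x; rewrite [x]tuple0.
by rewrite integral_cst//= diracT mule1.
Qed.

Lemma ge0_integral_RnS n (phi : Rn R n.+1 -> \bar R) :
  measurable_fun setT phi -> (forall z, 0 <= phi z) ->
  \int[lebesgue_Rn n.+1]_x phi x =
  \int[lambda]_z \int[lebesgue_Rn n]_y phi (cons_Rn (z, y)).
Proof.
move=> mphi phi0.
transitivity (\int[lambda \x lebesgue_Rn n]_x (phi \o (@cons_Rn R n)) x).
  rewrite -(ge0_integral_pushforward (@measurable_cons_Rn R n)
    (lambda \x lebesgue_Rn n) measurableT mphi)//.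
rewrite fubini_tonelli1//; last by move=> z /=.
exact: (measurableT_comp mphi (@measurable_cons_Rn R n)).
Qed.

(** One formula, two readings of x + t v: in [y] it is the translation along the free flow, in [x]
    it is the dilation whose Jacobian produces dispersion. *)
Definition affine_Rn n (a : R) (y x : Rn R n) : Rn R n :=
  [tuple (tnth y i + a * tnth x i)%R | i < n].

Lemma affine_Rn_cons n a (y0 z : R) (y x : Rn R n) :
  affine_Rn a (cons_Rn (y0, y)) (cons_Rn (z, x)) =
  cons_Rn ((y0 + a * z)%R, affine_Rn a y x).
Proof.
apply: eq_from_tnth => i; rewrite tnth_mktuple.
have [j ->|->] := unliftP ord0 i; first by rewrite !tnthS/= tnth_mktuple.
by rewrite !tnth0.
Qed.

Lemma measurable_affine_Rn d (T : measurableType d) n (a : T -> R)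
    (y x : T -> Rn R n) : measurable_fun setT a ->
  measurable_fun setT y -> measurable_fun setT x ->
  measurable_fun setT (fun w => affine_Rn (a w) (y w) (x w)).
Proof.
move=> ma my mx; apply/measurable_fun_tnthP => i.
rewrite (_ : _ \o _ = (fun w => tnth (y w) i + a w * tnth (x w) i)%R); last first.
  by apply/funext => w /=; rewrite tnth_mktuple.
apply: measurable_funD.
  exact: (measurableT_comp (measurable_tnth i) my).
apply: measurable_funM => //.
exact: (measurableT_comp (measurable_tnth i) mx).
Qed.

(** With [a] = -t this is the dispersion identity. Induction on the dimension: each coordinate
    contributes one factor [|a|^-1]. *)
Lemma ge0_integral_affine_Rn n (a : R) (y : Rn R n) (phi : Rn R n -> \bar R) :
  a != 0%R -> measurable_fun setT phi -> (forall x, 0 <= phi x) ->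
  \int[lebesgue_Rn n]_x phi (affine_Rn a y x) =
  (`|a| ^- n)%:E * \int[lebesgue_Rn n]_x phi x.
Proof.
move=> a0; elim: n y phi => [|n IHn] y phi mphi phi0.
  rewrite !integral_Rn0 expr0 invr1 mul1e; congr phi.
  by apply: eq_from_tnth => -[].
rewrite !ge0_integral_RnS//; last first.
  by apply: (measurableT_comp mphi); exact: measurable_affine_Rn.
have [y0 [y1 ->]] : exists y0 y1, y = cons_Rn (y0, y1).
  by case/tupleP: y => y0 y1; exists y0, y1; apply: val_inj.
have mc z : measurable_fun setT (fun x : Rn R n => phi (cons_Rn (z, x))).
  apply: (measurableT_comp mphi).
  exact: (measurable_cons (measurable_cst z) (@measurable_id _ _ setT)).
transitivity (\int[lambda]_z ((`|a| ^- n)%:E *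
    \int[lebesgue_Rn n]_x phi (cons_Rn ((y0 + a * z)%R, x)))).
  apply: eq_integral => z _.
  under eq_integral do rewrite affine_Rn_cons.
  by rewrite (IHn _ (fun x => phi (cons_Rn (_, x)))).
have mI : measurable_fun setT (fun z =>
    \int[lebesgue_Rn n]_x phi (cons_Rn (z, x))).
  have := @measurable_fun_fubini_tonelli_F _ _ (measurableTypeR R) (Rn R n) R
    (lebesgue_Rn n) (phi \o (@cons_Rn R n)).
  apply; last by move=> z /=.
  exact: (measurableT_comp mphi (@measurable_cons_Rn R n)).
rewrite ge0_integralZl//; last 2 first.
- have mg : measurable_fun setT (fun z : measurableTypeR R =>
      (y0 + a * z)%R : measurableTypeR R).
    by apply: measurable_funD => //; exact: measurable_funM.
  exact: (measurableT_comp mI mg).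
- by move=> z _; exact: integral_ge0.
rewrite (@ge0_integral_affine a y0 (fun z =>
  \int[lebesgue_Rn n]_x phi (cons_Rn (z, x))))//; last first.
  by move=> z; exact: integral_ge0.
by rewrite muleA -EFinM exprSr invfM.
Qed.

End affine_change_of_variables.

(** * Powers of extended reals and Hoelder's inequality *)

Section ereal_power.
Context {R : realType}.
Implicit Types (x y : \bar R) (r s : R).

Lemma ge0_le_poweR r x y : (0 <= r)%R -> 0 <= x -> x <= y ->
  x `^ r <= y `^ r.
Proof.
move=> r0 x0 xy; apply: gt0_ler_poweR => //; rewrite in_itv/= leey ?andbT//.
exact: le_trans xy.
Qed.

Lemma gt0_lt_poweR r x y : (0 < r)%R -> 0 <= x -> x < y -> x `^ r < y `^ r.
Proof.
move=> r0 x0 xy; rewrite ltNge; apply/negP => yx.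
have y0 : 0 <= y by rewrite (le_trans x0)// ltW.
have : (y `^ r) `^ r^-1 <= (x `^ r) `^ r^-1.
  by apply: ge0_le_poweR => //; rewrite ?invr_ge0 ?poweR_ge0// ltW.
by rewrite -!poweRrM !divff ?gt_eqF// !poweRe1// leNgt xy.
Qed.

Lemma poweRK r x : r != 0%R -> 0 <= x -> (x `^ r) `^ r^-1 = x.
Proof. by move=> r0 x0; rewrite -poweRrM divff// poweRe1. Qed.

Lemma poweRVK r x : r != 0%R -> 0 <= x -> (x `^ r^-1) `^ r = x.
Proof. by move=> r0 x0; rewrite -poweRrM mulVf// poweRe1. Qed.

Lemma ge0_poweRD x r s : (0 <= r)%R -> (0 <= s)%R -> (0 < r + s)%R ->
  x `^ (r + s) = x `^ r * x `^ s.
Proof.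
by move=> r0 s0 rs0; rewrite poweRD// add_neq0_poweRD_def// gt_eqF.
Qed.

Lemma poweR_young (t : R) x y : (0 < t < 1)%R -> 0 <= x -> 0 <= y ->
  x `^ t * y `^ (1 - t) <= t%:E * x + (1 - t)%:E * y.
Proof.
move=> /andP[t0 t1] x0 y0; have t1' : (0 < 1 - t)%R by rewrite subr_gt0.
have tE : t%:E * +oo = +oo by rewrite gt0_muley.
have t'E : (1 - t)%:E * +oo = +oo by rewrite gt0_muley.
have nNy z (a : R) : (0 <= a)%R -> 0 <= z -> a%:E * z != -oo.
  by move=> a0 z0; rewrite gt_eqF// (lt_le_trans (ltNyr 0))// mule_ge0.
have [xE|xy] := eqVneq x +oo.
  by rewrite xE tE addye ?leey// nNy// ltW.
have [yE|yy] := eqVneq y +oo.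
  by rewrite yE t'E addey ?leey// nNy// ltW.
case: x x0 xy => [x| |]// x0 _; case: y y0 yy => [y| |]// y0 _.
rewrite !poweR_EFin -!EFinM -EFinD lee_fin; rewrite !lee_fin in x0 y0.
have ti : (0 < t^-1)%R by rewrite invr_gt0.
have ti' : (0 < (1 - t)^-1)%R by rewrite invr_gt0.
have tt : (t^-1^-1 + (1 - t)^-1^-1 = 1)%R by rewrite !invrK addrC subrK.
have := conjugate_powR (powR_ge0 x t) (powR_ge0 y (1 - t)) ti ti' tt.
rewrite -!powRrM !divff ?gt_eqF// !powRr1// !invrK.
by rewrite [(x * t)%R]mulrC [(y * (1 - t))%R]mulrC.
Qed.

End ereal_power.

Section hoelder_poweR.
Context d (T : measurableType d) {R : realType}.
Variable mu : {measure set T -> \bar R}.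

Lemma measurableT_comp_poweR (f : T -> \bar R) (r : R) :
  measurable_fun setT f -> measurable_fun setT (fun x => f x `^ r).
Proof. by move=> mf; exact: (measurableT_comp (measurable_poweR r) mf). Qed.

Lemma ge0_integral_eq0_ae (f : T -> \bar R) : measurable_fun setT f ->
  (forall x, 0 <= f x) -> \int[mu]_x f x = 0 -> ae_eq mu setT f (cst 0).
Proof.
move=> mf f0 If; apply/(ae_eq_integral_abs mu measurableT mf).
by rewrite -[RHS]If; apply: eq_integral => x _; rewrite gee0_abs.
Qed.

(** Stated with weights [t] and [1 - t] rather than conjugate exponents, so that the endpoints are
    included: [t] = 1 occurs in the interpolation when b = c. *)
Lemma hoelder_poweR (f g : T -> \bar R) (t : R) : (0 <= t <= 1)%R ->
  measurable_fun setT f -> measurable_fun setT g ->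
  (forall x, 0 <= f x) -> (forall x, 0 <= g x) ->
  \int[mu]_x (f x `^ t * g x `^ (1 - t)) <=
  (\int[mu]_x f x) `^ t * (\int[mu]_x g x) `^ (1 - t).
Proof.
move=> /andP[t0 t1] mf mg f0 g0.
have If0 : 0 <= \int[mu]_x f x by exact: integral_ge0.
have Ig0 : 0 <= \int[mu]_x g x by exact: integral_ge0.
have [->|t_neq0] := eqVneq t 0%R.
  rewrite subr0 poweRe0 mul1e poweRe1//; under eq_integral.
    by move=> x _; rewrite poweRe0 mul1e poweRe1//; over.
  by [].
have [->|t_neq1] := eqVneq t 1%R.
  rewrite subrr poweRe0 mule1 poweRe1//; under eq_integral.
    by move=> x _; rewrite poweRe0 mule1 poweRe1//; over.
  by [].
have {}t0 : (0 < t)%R by rewrite lt0r t_neq0.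
have {}t1 : (t < 1)%R by rewrite lt_neqAle t_neq1.
have t1' : (0 < 1 - t)%R by rewrite subr_gt0.
have mfg : measurable_fun setT (fun x => f x `^ t * g x `^ (1 - t)).
  by apply: emeasurable_funM; exact: measurableT_comp_poweR.
have [If|If] := eqVneq (\int[mu]_x f x) 0.
  rewrite If poweR0r// mul0e le_eqVlt; apply/orP; left; apply/eqP.
  rewrite (@ge0_ae_eq_integral _ _ _ mu setT _ (cst 0))//; last 2 first.
  - by move=> x _; rewrite mule_ge0// poweR_ge0.
  - have := ge0_integral_eq0_ae mf f0 If; apply: filterS => x /(_ I) /= fx _.
    by rewrite fx poweR0r// mul0e.
  by rewrite integral0.
have [Ig|Ig] := eqVneq (\int[mu]_x g x) 0.
  rewrite Ig poweR0r ?gt_eqF// mule0 le_eqVlt; apply/orP; left; apply/eqP.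
  rewrite (@ge0_ae_eq_integral _ _ _ mu setT _ (cst 0))//; last 2 first.
  - by move=> x _; rewrite mule_ge0// poweR_ge0.
  - have := ge0_integral_eq0_ae mg g0 Ig; apply: filterS => x /(_ I) /= gx _.
    by rewrite gx poweR0r ?gt_eqF// mule0.
  by rewrite integral0.
have {}If : 0 < \int[mu]_x f x by rewrite lt0e If.
have {}Ig : 0 < \int[mu]_x g x by rewrite lt0e Ig.
have [Ify|Ify] := eqVneq (\int[mu]_x f x) +oo.
  by rewrite Ify poweRyr ?gt_eqF// gt0_mulye ?leey// poweR_gt0.
have [Igy|Igy] := eqVneq (\int[mu]_x g x) +oo.
  by rewrite Igy poweRyr ?gt_eqF// gt0_muley ?leey// poweR_gt0.
have [A0 AE] : (0 < fine (\int[mu]_x f x))%R /\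
    \int[mu]_x f x = (fine (\int[mu]_x f x))%:E.
  by rewrite fineK ?fine_gt0 ?ge0_fin_numE// ?ltey ?If// ltey Ify.
have [B0 BE] : (0 < fine (\int[mu]_x g x))%R /\
    \int[mu]_x g x = (fine (\int[mu]_x g x))%:E.
  by rewrite fineK ?fine_gt0 ?ge0_fin_numE// ?ltey ?Ig// ltey Igy.
set A := fine (\int[mu]_x f x) in A0 AE *.
set B := fine (\int[mu]_x g x) in B0 BE *.
pose K := (A `^ t * B `^ (1 - t))%R.
have K0 : (0 <= K)%R by rewrite mulr_ge0// powR_ge0.
(* Young's inequality is applied to [f / A] and [g / B], whose integrals are 1, so the convex
   combination integrates to t + (1 - t) = 1. *)
apply: (@le_trans _ _ (\int[mu]_x (K%:E * ((t / A)%:E * f x +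
    ((1 - t) / B)%:E * g x)))).
  apply: ge0_le_integral => //.
  - by move=> x _; rewrite mule_ge0// poweR_ge0.
  - by apply: measurable_funeM; apply: emeasurable_funD; exact: measurable_funeM.
  - move=> x _.
    have AV0 : 0 <= A^-1%:E by rewrite lee_fin invr_ge0 ltW.
    have BV0 : 0 <= B^-1%:E by rewrite lee_fin invr_ge0 ltW.
    have t01 : (0 < t < 1)%R by rewrite t0 t1.
    have := poweR_young t01 (mule_ge0 AV0 (f0 x)) (mule_ge0 BV0 (g0 x)).
    rewrite !muleA -!EFinM -(@lee_pmul2l _ K%:E)//; last first.
      by rewrite lte_fin mulr_gt0// powR_gt0.
    apply: le_trans; rewrite !poweRM// !poweR_EFin.
    rewrite muleACA -EFinM muleA -EFinM /K mulrACA.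
    rewrite -(powRM _ (ltW A0)) ?invr_ge0 ?(ltW A0)//.
    rewrite -(powRM _ (ltW B0)) ?invr_ge0 ?(ltW B0)//.
    by rewrite !divff ?gt_eqF// !powR1 mulr1 mul1e.
rewrite ge0_integralZl//; last 2 first.
- by apply: emeasurable_funD; exact: measurable_funeM.
- move=> x _; rewrite adde_ge0// mule_ge0// lee_fin divr_ge0// ltW//.
rewrite ge0_integralD//; last 4 first.
- by move=> x _; rewrite mule_ge0// lee_fin divr_ge0// ltW.
- exact: measurable_funeM.
- by move=> x _; rewrite mule_ge0// lee_fin divr_ge0// ltW.
- exact: measurable_funeM.
rewrite !ge0_integralZl ?lee_fin ?divr_ge0
  ?(ltW A0) ?(ltW B0) ?(ltW t0) ?(ltW t1')//.
rewrite AE BE (_ : (t / A)%:E * A%:E + ((1 - t) / B)%:E * B%:E = 1).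
  by rewrite mule1 /K EFinM !poweR_EFin.
by congr EFin; rewrite !mulfVK ?gt_eqF// addrC subrK.
Qed.

End hoelder_poweR.

(** * Free transport and velocity averages *)

Section transport_lemmas.
Context {R : realType} (n : nat).
Local Notation V := (Rn R n).
Local Notation mu := (@lebesgue_Rn R n).

Lemma affine_RnD (s t : R) (x v : V) :
  affine_Rn s (affine_Rn t x v) v = affine_Rn (t + s) x v.
Proof.
by apply: eq_from_tnth => i; rewrite !tnth_mktuple mulrDl addrA.
Qed.

Lemma affine_Rn0 (x v : V) : affine_Rn 0 x v = x.
Proof. by apply: eq_from_tnth => i; rewrite tnth_mktuple mul0r addr0. Qed.

Lemma transportE (t : R) (f : V * V -> R) (x v : V) :
  transport t f (x, v) = f (affine_Rn (- t) x v, v).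
Proof.
rewrite /transport /=; congr (f (_, _)); apply: eq_from_tnth => i.
by rewrite !tnth_mktuple mulNr.
Qed.

Lemma ge0_integral_translate (t : R) (v : V) (phi : V -> \bar R) :
  measurable_fun setT phi -> (forall x, 0 <= phi x) ->
  \int[mu]_x phi (affine_Rn t x v) = \int[mu]_x phi x.
Proof.
move=> mphi phi0.
transitivity (\int[mu]_x phi (affine_Rn 1 [tuple (t * tnth v i)%R | i < n] x)).
  apply: eq_integral => x _; congr phi; apply: eq_from_tnth => i.
  by rewrite !tnth_mktuple mul1r addrC.
by rewrite ge0_integral_affine_Rn ?oner_neq0// normr1 expr1n invr1 mul1e.
Qed.

Section measurability.
Context d (T : measurableType d) d' (U : measurableType d').

Lemma measurableT_comp_transport (f : V * V -> U) (a : T -> R) (x v : T -> V) :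
  measurable_fun setT f -> measurable_fun setT a ->
  measurable_fun setT x -> measurable_fun setT v ->
  measurable_fun setT (fun w => f (affine_Rn (a w) (x w) (v w), v w)).
Proof.
move=> mf ma mx mv; apply: (measurableT_comp mf).
by apply: measurable_fun_pair => //; exact: measurable_affine_Rn.
Qed.

End measurability.

Lemma measurable_comp_transport d (U : measurableType d) (f : V * V -> U) t :
  measurable_fun setT f ->
  measurable_fun setT (fun z : V * V => f (affine_Rn t z.1 z.2, z.2)).
Proof. by move=> mf; apply: measurableT_comp_transport. Qed.

(** Conservation of mass: for fixed v the flow is a translation in x, so Tonelli reduces it to
    translation invariance. *)
Lemma ge0_integral_transport (g : V * V -> \bar R) (t : R) :
  measurable_fun setT g -> (forall z, 0 <= g z) ->
  \int[mu]_x \int[mu]_v g (affine_Rn t x v, v) =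
  \int[mu]_x \int[mu]_v g (x, v).
Proof.
move=> mg g0.
have := @fubini_tonelli _ _ _ _ _ mu mu (fun z => g (affine_Rn t z.1 z.2, z.2)).
move=> /(_ (measurable_comp_transport t mg) (fun=> g0 _)) E1.
apply: (etrans E1) => {E1}.
apply: (etrans _ (esym (@fubini_tonelli _ _ _ _ _ mu mu g mg g0))).
apply: eq_integral => v _.
rewrite -(@ge0_integral_translate t v (fun x => g (x, v)))//.
apply: (measurableT_comp mg); exact: measurable_fun_pair.
Qed.

(** The Jacobian of (x, v) |-> (x + t v, x + s v) is obtained in two one-variable moves: for fixed v
    translate x by -s v, then for fixed x dilate v by t - s. *)
Lemma ge0_integral_transport2 (phi psi : V -> \bar R) (t s : R) : t != s ->
  measurable_fun setT phi -> (forall x, 0 <= phi x) ->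
  measurable_fun setT psi -> (forall x, 0 <= psi x) ->
  \int[mu]_x \int[mu]_v (phi (affine_Rn t x v) * psi (affine_Rn s x v)) =
  (`|t - s| ^- n)%:E * (\int[mu]_x phi x * \int[mu]_x psi x).
Proof.
move=> ts mphi phi0 mpsi psi0.
have mshift r : measurable_fun setT (fun z : V * V => affine_Rn r z.1 z.2).
  exact: measurable_affine_Rn.
have mpr r r' : measurable_fun setT (fun z : V * V =>
    phi (affine_Rn r z.1 z.2) * psi (affine_Rn r' z.1 z.2)).
  by apply: emeasurable_funM; [apply: (measurableT_comp mphi)|
    apply: (measurableT_comp mpsi)].
have E1 := @fubini_tonelli _ _ _ _ _ mu mu (fun z =>
  phi (affine_Rn t z.1 z.2) * psi (affine_Rn s z.1 z.2)) (mpr t s)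
  (fun=> mule_ge0 (phi0 _) (psi0 _)).
apply: (etrans E1) => {E1}.
transitivity (\int[mu]_v \int[mu]_x (phi (affine_Rn (t - s) x v) * psi x)).
  apply: eq_integral => v _.
  rewrite -[RHS](@ge0_integral_translate s v)/=; last 2 first.
  - apply: emeasurable_funM => //; apply: (measurableT_comp mphi).
    exact: measurable_affine_Rn.
  - by move=> x; exact: mule_ge0.
  by apply: eq_integral => x _; rewrite affine_RnD addrC subrK.
have mpr' : measurable_fun setT (fun z : V * V =>
    phi (affine_Rn (t - s) z.1 z.2) * psi z.1).
  apply: emeasurable_funM; first exact: (measurableT_comp mphi).
  exact: (measurableT_comp mpsi).
have E1 := @fubini_tonelli _ _ _ _ _ mu mu (fun z =>
  phi (affine_Rn (t - s) z.1 z.2) * psi z.1) mpr'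
  (fun=> mule_ge0 (phi0 _) (psi0 _)).
apply: (etrans (esym E1)) => {E1}.
transitivity (\int[mu]_x (((`|t - s| ^- n)%:E * \int[mu]_y phi y) * psi x)).
  apply: eq_integral => x _ /=.
  rewrite ge0_integralZr//; last first.
    by apply: (measurableT_comp mphi); exact: measurable_affine_Rn.
  by rewrite ge0_integral_affine_Rn// subr_eq0.
rewrite ge0_integralZl//; first by rewrite muleA.
by rewrite mule_ge0 ?integral_ge0// lee_fin invr_ge0 exprn_ge0.
Qed.

Definition vavg (F : V * V -> R) (t : R) (x : V) : \bar R :=
  \int[mu]_v (F (affine_Rn (- t) x v, v))%:E.

Lemma vavg_ge0 (F : V * V -> R) t x : (forall z, 0 <= F z)%R -> 0 <= vavg F t x.
Proof. by move=> F0; apply: integral_ge0 => v _; rewrite lee_fin. Qed.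

Lemma measurable_vavg2 (F : V * V -> R) :
  measurable_fun setT F -> (forall z, 0 <= F z)%R ->
  measurable_fun setT (fun z : R * V => vavg F z.1 z.2).
Proof.
move=> mF F0.
have := @measurable_fun_fubini_tonelli_F _ _ (R * V)%type V R mu
  (fun z => (F (affine_Rn (- z.1.1) z.1.2 z.2, z.2))%:E).
apply; last by move=> z; rewrite lee_fin.
apply/measurable_EFinP.
apply: (measurableT_comp_transport (a := fun z : R * V * V => - z.1.1)%R) => //.
  apply: measurableT_comp => //.
  exact: (measurableT_comp measurable_fst measurable_fst).
exact: (measurableT_comp measurable_snd measurable_fst).
Qed.

Lemma measurable_vavg (F : V * V -> R) t :
  measurable_fun setT F -> (forall z, 0 <= F z)%R ->
  measurable_fun setT (vavg F t).
Proof.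
move=> mF F0; apply: (@measurableT_comp _ _ _ _ _ _
  (fun z : R * V => vavg F z.1 z.2) _ (fun x => (t, x))).
  exact: measurable_vavg2.
exact: measurable_fun_pair.
Qed.

End transport_lemmas.

(** * Interpolation with the dispersive endpoint *)

Section positive_integrable.
Context d (T : measurableType d) {R : realType}.

(** Used to perturb a nonnegative function into a positive one while its integral grows by at most
    [e]. The witness is a series of small multiples of the indicators of a cover by sets of finite
    measure. *)
Lemma exists_positive_integrable (mu : {sigma_finite_measure set T -> \bar R})
    (e : R) : (0 < e)%R ->
  exists k : T -> R, [/\ measurable_fun setT k, forall x, (0 < k x)%R &
    \int[mu]_x (k x)%:E <= e%:E].
Proof.
move=> e0; have [F TF mF] := sigma_finiteT mu.
have mF' j : measurable (F j) by have [] := mF j.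
have muF j : mu (F j) = (fine (mu (F j)))%:E.
  by rewrite fineK// ge0_fin_numE//; have [] := mF j.
pose m j := (1 + fine (mu (F j)))%R.
have m1 j : (1 <= m j)%R by rewrite /m lerDl fine_ge0.
have m0 j : (0 < m j)%R by rewrite (lt_le_trans ltr01).
(* Since [m j] is at least 1 the series is pointwise at most [e], hence finite; since [m j] is at
   least the measure of [F j] its integral is at most [e] as well. *)
pose a j := (e / 2 ^ j.+1 / m j)%R.
have a0 j : (0 < a j)%R by rewrite !divr_gt0.
have ae j : (a j <= e / 2 ^ j.+1)%R.
  by rewrite ler_pdivrMr// ler_peMr// divr_ge0// ltW.
pose g j x := (a j * \1_(F j) x)%:E.
have g0 j x : 0 <= g j x by rewrite lee_fin mulr_ge0// ltW.
have mg j : measurable_fun setT (g j).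
  by apply/measurable_EFinP; exact: measurable_funM.
pose G x := \sum_(0 <= j <oo) g j x.
have G0 x : 0 <= G x by exact: nneseries_ge0.
have sum_e : \sum_(0 <= j <oo) (e / 2 ^ j.+1)%:E <= e%:E.
  apply: le_trans (epsilon_trick0 xpredT (ltW e0)).
  by apply: lee_nneseries => // j _; rewrite ?lee_fin ?natrX// divr_ge0// ltW.
have Ge x : G x <= e%:E.
  apply: le_trans sum_e; apply: lee_nneseries => // j _.
  by rewrite lee_fin (le_trans _ (ae j))// ler_piMr ?(ltW (a0 j)).
have Gfin x : G x \is a fin_num.
  by rewrite ge0_fin_numE// (le_lt_trans (Ge x))// ltry.
have mG : measurable_fun setT G.
  by apply: ge0_emeasurable_sum => // k x _ _.
exists (fine \o G); split.
- by apply: measurableT_comp => //; exact: fine_measurable.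
- move=> x; rewrite /= fine_gt0//.
  rewrite [X in _ && X](le_lt_trans (Ge x)) ?ltry// andbT.
  have [j _ Fjx] : (\bigcup_i F i) x by rewrite -TF.
  apply: (@lt_le_trans _ _ (g j x)).
    by rewrite lte_fin mulr_gt0// indicE mem_set.
  apply: le_trans (nneseries_lim_ge j.+1 _) => //.
  rewrite big_nat_recr//= leeDr//; apply: sume_ge0 => i _; exact: g0.
under eq_integral do rewrite /= fineK//.
rewrite integral_nneseries//; apply: le_trans sum_e.
apply: lee_nneseries => [j _ _|j _]; first exact: integral_ge0.
rewrite /g; under eq_integral do rewrite EFinM.
rewrite ge0_integralZl//; last 2 first.
- by apply/measurable_EFinP; exact: measurable_indic.
- by rewrite lee_fin ltW.
rewrite integral_indic// setIT.
rewrite (_ : (a j)%:E * _ = (a j * fine (mu (F j)))%:E); last first.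
  by rewrite [RHS]EFinM -muF.
rewrite lee_fin.
rewrite /a -mulrA ler_piMr ?divr_ge0 ?(ltW e0)//.
by rewrite mulrC ler_pdivrMr// mul1r /m lerDr.
Qed.

End positive_integrable.

Section interpolation.
Context {R : realType} (n : nat).
Local Notation V := (Rn R n).
Local Notation mu := (@lebesgue_Rn R n).

(* The dispersive endpoint L^1_x L^oo_v is interpolated with a Lebesgue space in
   which x and v play the same role: F = M(x)^(1 - th) H(x, v)^th, where M(x) is
   the b-th power of the norm of F(x, .) in L^c. *)
Lemma transport_interpolation (F : V * V -> R) (b c th A e : R) :
  measurable_fun setT F -> (forall z, 0 <= F z)%R ->
  (0 < b)%R -> (0 < c)%R -> (0 < th <= 1)%R -> (th = 1 + c^-1 - b^-1)%R ->
  (0 < e)%R ->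
  \int[mu]_x (\int[mu]_v (F (x, v) `^ c)%:E) `^ (b / c) <= A%:E ->
  exists H : V * V -> R, [/\ measurable_fun setT H, forall z, (0 <= H z)%R,
    \int[mu]_x \int[mu]_v (H (x, v) `^ (th * c))%:E <= (A + e)%:E &
    forall t x, t != 0%R -> vavg F t x <=
      ((`|t| ^- n * (A + e))%:E) `^ (1 - th) * (vavg H t x) `^ th].
Proof.
move=> mF F0 b0 c0 /andP[th0 th1] thE e0 FA.
have [k [mk k0 ke]] := exists_positive_integrable mu e0.
pose I x := \int[mu]_v (F (x, v) `^ c)%:E.
have mI : measurable_fun setT I.
  have := @measurable_fun_fubini_tonelli_F _ _ V V R mu
    (fun z => (F z `^ c)%:E).
  apply; last by move=> z; rewrite lee_fin powR_ge0.
  apply/measurable_EFinP.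
  exact: (measurableT_comp (measurable_powR c) mF).
have I0 x : 0 <= I x by apply: integral_ge0 => v _; rewrite lee_fin powR_ge0.
pose J x := I x `^ (b / c).
have mJ : measurable_fun setT J by exact: measurableT_comp_poweR.
have J0 x : 0 <= J x by exact: poweR_ge0.
(* [fine] sends an infinite [J x] to 0, which is harmless because [J] is finite almost everywhere.
   The maximum with [k] keeps [M] positive, so negative powers of it make sense. *)
pose M x := Num.max (fine (J x)) (k x).
have M0 x : (0 < M x)%R by rewrite lt_max k0 orbT.
have mfJ : measurable_fun setT (fine \o J).
  by apply: measurableT_comp => //; exact: fine_measurable.
have mM : measurable_fun setT M by apply: measurable_maxr.
have IM : \int[mu]_x (M x)%:E <= (A + e)%:E.
  apply: (@le_trans _ _ (\int[mu]_x (J x + (k x)%:E))).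
    apply: ge0_le_integral => //.
    - by move=> x _; rewrite lee_fin ltW.
    - exact/measurable_EFinP.
    - by apply: emeasurable_funD => //; exact/measurable_EFinP.
    - move=> x _; rewrite /M EFin_max ge_max; apply/andP; split.
        case: (J x) (J0 x) => [r r0| |]//=; rewrite ?leey// -EFinD lee_fin.
        by rewrite lerDl ltW.
      by rewrite leeDr// J0.
  rewrite ge0_integralD//; last 2 first.
  - by move=> x _; rewrite lee_fin ltW.
  - exact/measurable_EFinP.
  by rewrite EFinD leeD.
have Jfin : {ae mu, forall x, J x \is a fin_num}.
  have : mu.-integrable setT J.
    apply/integrableP; split => //; under eq_integral do rewrite gee0_abs//.
    by rewrite (le_lt_trans FA)// ltry.
  move=> /(integrable_ae measurableT); apply: filterS => x; exact.
pose W x := (M x `^ (- (1 - th)))%R.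
have W0 x : (0 < W x)%R by rewrite powR_gt0.
(* Solves F = M^(1 - th) H^th for H. *)
pose H z := ((F z * W z.1) `^ th^-1)%R.
have mW : measurable_fun setT W.
  exact: (measurableT_comp (measurable_powR _) mM).
have mFW : measurable_fun setT (fun z : V * V => F z * W z.1)%R.
  apply: measurable_funM; first exact: mF.
  exact: (measurableT_comp mW measurable_fst).
have FW0 z : (0 <= F z * W z.1)%R by rewrite mulr_ge0// ltW.
have mH : measurable_fun setT H.
  exact: (measurableT_comp (measurable_powR _) mFW).
have Hth z : (H z `^ th = F z * W z.1)%R.
  by rewrite /H -powRrM mulVf ?gt_eqF// powRr1.
have H0 z : (0 <= H z)%R by exact: powR_ge0.
exists H; split => //.
- apply: le_trans IM; apply: ae_ge0_le_integral; first exact: measurableT.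
  + move=> x _; apply: integral_ge0 => v _; rewrite lee_fin powR_ge0//.
  + have := @measurable_fun_fubini_tonelli_F _ _ V V R mu
      (fun z => (H z `^ (th * c))%:E).
    apply; last by move=> z; rewrite lee_fin powR_ge0.
    apply/measurable_EFinP.
    exact: (measurableT_comp (measurable_powR _) mH).
  + by move=> x _; rewrite lee_fin ltW.
  + exact/measurable_EFinP.
  apply: filterS Jfin => x Jx _.
  under eq_integral => v _.
    rewrite powRrM Hth powRM//; last exact: ltW.
    rewrite EFinM /=; over.
  rewrite ge0_integralZr//; last 3 first.
  + apply/measurable_EFinP.
    apply: (measurableT_comp (measurable_powR _)).
    by apply: (measurableT_comp mF); exact: measurable_fun_pair.
  + by move=> v _; rewrite lee_fin powR_ge0.
  + by rewrite lee_fin powR_ge0.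
  rewrite -/(I x).
  have IMx : I x <= (M x `^ (c / b))%:E.
    have -> : I x = J x `^ (c / b).
      by rewrite /J -poweRrM mulrA mulfVK ?gt_eqF// divff ?gt_eqF// poweRe1.
    rewrite -[J x]fineK// poweR_EFin lee_fin ge0_ler_powR//.
    + by rewrite divr_ge0// ltW.
    + by rewrite nnegrE fine_ge0.
    + by rewrite nnegrE ltW.
    + by rewrite /M le_max lexx.
  apply: (@le_trans _ _ ((M x `^ (c / b))%:E * (W x `^ c)%:E)).
    by rewrite lee_wpmul2r// lee_fin powR_ge0.
  rewrite -EFinM lee_fin /W -powRrM -powRD; last by rewrite (gt_eqF (M0 x)) implybT.
  (* This identity dictates the value of [th]: the integral of H^(th c) in v is at most the first
     power of M. *)
  rewrite (_ : (c / b + - (1 - th) * c)%R = 1%R) ?powRr1 ?(ltW (M0 x))//.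
  by rewrite thE; field; rewrite !gt_eqF.
- move=> t x t0.
  rewrite muleC.
  pose h v := (H (affine_Rn (- t) x v, v))%:E.
  pose g v := (M (affine_Rn (- t) x v))%:E.
  have mh : measurable_fun setT h.
    apply/measurable_EFinP.
    by apply: measurableT_comp_transport.
  have maff : measurable_fun setT (fun v : V => affine_Rn (- t) x v).
    exact: measurable_affine_Rn.
  have mg : measurable_fun setT g.
    by apply/measurable_EFinP; exact: (measurableT_comp mM maff).
  have -> : vavg F t x = \int[mu]_v (h v `^ th * g v `^ (1 - th)).
    apply: eq_integral => v _; rewrite /h /g !poweR_EFin Hth -EFinM /=.
    congr EFin; rewrite -mulrA /W -powRD; last by rewrite (gt_eqF (M0 _)) implybT.
    by rewrite addNr powRr0 mulr1.
  apply: le_trans (hoelder_poweR mu _ mh mg _ _) _.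
  + by rewrite ltW.
  + by move=> v; rewrite lee_fin.
  + by move=> v; rewrite lee_fin ltW.
  rewrite lee_wpmul2l ?poweR_ge0//.
  apply: ge0_le_poweR; rewrite ?subr_ge0//.
    by apply: integral_ge0 => v _; rewrite lee_fin ltW.
  have tn0 : (- t != 0)%R by rewrite oppr_eq0.
  have mMe : measurable_fun setT (fun y => (M y)%:E) by exact/measurable_EFinP.
  have M0e y : 0 <= (M y)%:E by rewrite lee_fin ltW.
  rewrite [leLHS](ge0_integral_affine_Rn x tn0 mMe M0e) normrN EFinM.
  by rewrite lee_wpmul2l// lee_fin invr_ge0 exprn_ge0.
Qed.

End interpolation.

Section ge0_integral_fin.
Context d (T : measurableType d) {R : realType}.
Variable mu : {measure set T -> \bar R}.
Implicit Types f g : T -> R.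

Lemma ge0_integralZl_fin (c : R) f : (0 <= c)%R -> measurable_fun setT f ->
  (forall x, 0 <= f x)%R ->
  \int[mu]_x (c * f x)%:E = c%:E * \int[mu]_x (f x)%:E.
Proof.
move=> c0 mf f0; under eq_integral do rewrite EFinM.
rewrite ge0_integralZl ?lee_fin//; first exact/measurable_EFinP.
by move=> x _; rewrite lee_fin.
Qed.

Lemma ge0_integralD_fin f g : measurable_fun setT f -> measurable_fun setT g ->
  (forall x, 0 <= f x)%R -> (forall x, 0 <= g x)%R ->
  \int[mu]_x (f x + g x)%:E = \int[mu]_x (f x)%:E + \int[mu]_x (g x)%:E.
Proof.
move=> mf mg f0 g0; under eq_integral do rewrite EFinD.
by rewrite ge0_integralD//; try exact/measurable_EFinP;
  move=> x _; rewrite lee_fin.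
Qed.

Lemma ge0_le_integral_fin f g : measurable_fun setT f ->
  measurable_fun setT g -> (forall x, 0 <= f x)%R ->
  (forall x, f x <= g x)%R -> \int[mu]_x (f x)%:E <= \int[mu]_x (g x)%:E.
Proof.
move=> mf mg f0 fg; apply: ge0_le_integral; first exact: measurableT.
- by move=> x _; rewrite lee_fin.
- exact/measurable_EFinP.
- exact/measurable_EFinP.
- by move=> x _; rewrite lee_fin.
Qed.

End ge0_integral_fin.

(** * The kernel |t - s|^-al integrated over sets of given measure *)

Section power_kernel.
Context {R : realType}.
Local Notation lambda := (@lebesgue_measure R).

Lemma ge0_integral_exhaustion_le d (T : measurableType d)
    (mu : {measure set T -> \bar R}) (F : (set T)^nat) (g : T -> \bar R) C :
  (forall k, measurable (F k)) -> nondecreasing_seq F ->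
  \bigcup_k F k = setT -> measurable_fun setT g -> (forall x, 0 <= g x) ->
  (forall k, \int[mu]_(x in F k) g x <= C) -> \int[mu]_x g x <= C.
Proof.
move=> mF ndF FT mg g0 FC.
have := @ge0_nondecreasing_set_cvg_integral _ _ _ F g mu ndF mF.
rewrite FT => /(_ (fun i => measurable_funS measurableT (@subsetT _ _) mg)).
move=> /(_ (fun _ _ _ => g0 _)) cvgF.
rewrite -(cvg_lim _ cvgF)//; apply: lime_le; first by apply/cvgP: cvgF.
exact: nearW.
Qed.

Variable al : R.
Hypothesis al01 : (0 < al < 1)%R.

Let ker (u : R) : R := (`|u| `^ (- al))%R.

Let ker_ge0 u : (0 <= ker u)%R. Proof. exact: powR_ge0. Qed.

Let measurable_ker : measurable_fun setT ker.
Proof.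
apply: (measurableT_comp (measurable_powR _)).
exact: normr_measurable.
Qed.

Let kerM (m u : R) : (0 <= m)%R -> (ker (m * u) = m `^ (- al) * ker u)%R.
Proof. by move=> m0; rewrite /ker normrM powRM// (ger0_norm m0). Qed.

Let measurable_ball (m : R) : measurable_fun setT (fun u : R => (`|u| <= m)%R).
Proof. by apply: measurable_fun_ler => //; exact: normr_measurable. Qed.

Let ind (m u : R) : R := if (`|u| <= m)%R then 1%R else 0%R.

Let measurable_ind (m : R) : measurable_fun setT (ind m).
Proof. by apply: measurable_fun_ifT => //; exact: measurable_ball. Qed.

Let ind0 (m u : R) : (0 <= ind m u)%R.
Proof. by rewrite /ind; case: ifP. Qed.

Let cut (m u : R) : R := if (`|u| <= m)%R then ker u else 0%R.

Let cut_ge0 m u : (0 <= cut m u)%R.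
Proof. by rewrite /cut; case: ifP. Qed.

Let measurable_cut m : measurable_fun setT (cut m).
Proof. by apply: measurable_fun_ifT => //; exact: measurable_ball. Qed.
#[local] Hint Resolve measurable_cut measurable_ker measurable_ball : core.

(** The solution of I = 2^(al - 1) I + 2 * 2^al. *)
Let C0 : R := (2 * 2 `^ al / (1 - 2 `^ (al - 1)))%R.

Let den_gt0 : (0 < 1 - 2 `^ (al - 1))%R.
Proof.
have /andP[_ al1] := al01.
rewrite -(opprB 1%R al) powRN subr_gt0 invf_lt1 ?powR_gt0//.
have := @gt0_ltr_powR R (1 - al); rewrite subr_gt0 => /(_ al1 1%R 2%R).
by rewrite powR1 !nnegrE ler01 ler0n ltr1n; exact.
Qed.

Let C0_gt0 : (0 < C0)%R.
Proof. by rewrite /C0 divr_gt0// mulr_gt0// powR_gt0. Qed.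

Let lebesgue_ball m : (0 <= m)%R ->
  \int[lambda]_u (ind m u)%:E = (2 * m)%:E.
Proof.
move=> m0; transitivity (\int[lambda]_u (\1_(`[(- m)%R, m]%classic) u : R)%:E).
  apply: eq_integral => u _; rewrite indicE /ind.
  by rewrite mem_setE in_itv/= ler_norml; case: ifP.
rewrite integral_indic// setIT /= lebesgue_measure_itv/= lte_fin.
have [m_gt0|m_le0] := ltP (- m)%R m.
  by rewrite -EFinB opprK mulr_natl mulr2n.
have -> : m = 0%R by lra.
by rewrite mulr0.
Qed.

Let integral_scale (f : R -> R) (m : R) : (0 < m)%R ->
  measurable_fun setT f -> (forall u, 0 <= f u)%R ->
  \int[lambda]_u (f u)%:E = m%:E * \int[lambda]_u (f (m * u)%R)%:E.
Proof.
move=> m0 mf f0; have mn0 : m != 0%R by rewrite gt_eqF.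
have mfE : measurable_fun setT (EFin \o f) by exact/measurable_EFinP.
have f0E u : 0 <= (EFin \o f) u by rewrite lee_fin.
transitivity (m%:E * (`|m|^-1%:E * \int[lambda]_u (f u)%:E)).
  by rewrite gtr0_norm// muleA -EFinM divff// mul1e.
congr (_ * _); have := ge0_integral_affine 0 mn0 mfE f0E => <-.
by apply: eq_integral => u _ /=; rewrite add0r.
Qed.

(** Self-similarity in place of an antiderivative. The part |u| <= 1/2 of the integral I is a copy
    of I scaled by 2^(al - 1), and on 1/2 < |u| <= 1 the kernel is at most 2^al. Absorbing the copy
    of I requires I to be finite, so the kernel is first restricted to where it is at most [j]. *)
Let integral_cut1 : \int[lambda]_u (cut 1 u)%:E <= C0%:E.
Proof.
have /andP[al0 al1] := al01.
pose F (j : nat) := [set u | (ker u <= j%:R)%R].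
have mF j : measurable (F j).
  rewrite -[F j]setTI; exact: (measurable_fun_ler measurable_ker
    (measurable_cst (j%:R : R))).
apply: (ge0_integral_exhaustion_le (mu := lambda) (F := F)) => //.
- move=> i j ij; apply/subsetPset => u; rewrite /F/= => /le_trans; apply.
  by rewrite ler_nat.
- apply/seteqP; split=> // u _.
  exists (Num.truncn (ker u)).+1 => //.
  by rewrite /F/= ltW// -truncn_lt_nat.
- by apply/measurable_EFinP; exact: measurable_cut.
- by move=> u; rewrite lee_fin.
move=> j; pose g m u := (if (ker u <= j%:R)%R then cut m u else 0)%R.
have mg' m : measurable_fun setT (g m).
  by apply: measurable_fun_ifT => //; exact: measurable_fun_ler.
have mg m : measurable_fun setT (EFin \o g m) by exact/measurable_EFinP.
have g0 m u : (0 <= g m u)%R by rewrite /g; case: ifP.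
have -> : \int[lambda]_(u in F j) (cut 1 u)%:E = \int[lambda]_u (g 1%R u)%:E.
  rewrite integral_mkcond; apply: eq_integral => u _; rewrite patchE /g.
  by case: ifP => [/set_mem/=->//|/negP uF]; case: ifPn => // /mem_set.
have gj : \int[lambda]_u (g 1%R u)%:E <= (j%:R * 2)%:E.
  rewrite EFinM -[in leRHS](mulr1 2%R) -lebesgue_ball//.
  rewrite -(ge0_integralZl_fin lambda (ler0n _ j) (measurable_ind 1) (ind0 1)).
  apply: ge0_le_integral_fin.
  - exact: mg'.
  - by apply: measurable_funM => //; exact: measurable_ind.
  - exact: g0.
  - move=> u; rewrite /g /cut /ind.
    by case: ifP => ?; case: ifP => ?; rewrite ?mulr1 ?mulr0.
have gfin : \int[lambda]_u (g 1%R u)%:E \is a fin_num.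
  rewrite ge0_fin_numE ?(le_lt_trans gj) ?ltry//.
  by apply: integral_ge0 => u _; rewrite lee_fin.
(* The restriction survives the scaling in the needed direction: the kernel at u/2 is 2^al >= 1
   times the kernel at u, so if it is at most [j] at u/2 then it is at u. *)
have ghalf : \int[lambda]_u (g 2^-1%R u)%:E <=
    (2 `^ (al - 1))%:E * \int[lambda]_u (g 1%R u)%:E.
  have half0 : (0 < 2^-1 :> R)%R by rewrite invr_gt0.
  rewrite (integral_scale half0 (mg' 2^-1%R) (g0 2^-1%R)).
  have -> : (2 `^ (al - 1) = 2^-1 * 2 `^ al :> R)%R.
    by rewrite powRD ?pnatr_eq0 ?implybT// powR_inv1// mulrC.
  rewrite EFinM -muleA lee_pmul2l ?lte_fin//.
  rewrite -(ge0_integralZl_fin lambda (powR_ge0 2 al) (mg' _) (g0 _)).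
  apply: ge0_le_integral_fin.
  - apply: (measurableT_comp (mg' _)); exact: measurable_funM.
  - by apply: measurable_funM => //; exact: mg'.
  - by move=> u.
  move=> u; rewrite /g /cut /ind kerM ?invr_ge0//.
  have -> : (2^-1 `^ (- al) = 2 `^ al :> R)%R.
    by rewrite -powR_inv1// -powRrM mulrN mulN1r opprK.
  rewrite normrM (@ger0_norm _ 2^-1%R)// ger_pMr//.
  have p1 : (1 <= 2 `^ al :> R)%R.
    by rewrite -[leLHS](powRr0 2) ler_powR ?ler1n// ltW.
  case: ifP => h1; last first.
    by rewrite mulr_ge0 ?powR_ge0//; case: ifP => // _; case: ifP.
  by rewrite (le_trans _ h1) ?ler_peMl//; case: ifP; rewrite ?mulr0.
have gsplit : \int[lambda]_u (g 1%R u)%:E <=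
    \int[lambda]_u (g 2^-1%R u)%:E + (2 * 2 `^ al)%:E.
  rewrite [X in _ + X](_ : _ = (2 `^ al)%:E * \int[lambda]_u (ind 1 u)%:E);
    last by rewrite lebesgue_ball// mulr1 -EFinM mulrC.
  rewrite -(ge0_integralZl_fin lambda (powR_ge0 2 al) (measurable_ind 1) (ind0 1)).
  have mpind : measurable_fun setT (fun u => 2 `^ al * ind 1 u)%R.
    by apply: measurable_funM => //; exact: measurable_ind.
  have pind0 u : (0 <= 2 `^ al * ind 1 u)%R by rewrite mulr_ge0 ?powR_ge0.
  rewrite -(ge0_integralD_fin lambda (mg' _) mpind (g0 _) pind0).
  apply: ge0_le_integral_fin.
  - exact: mg'.
  - apply: measurable_funD; first exact: mg'.
    by apply: measurable_funM => //; exact: measurable_ind.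
  - exact: g0.
  move=> u; rewrite /g /cut /ind.
  case: ifP => _; last by rewrite add0r mulr_ge0 ?powR_ge0//; case: ifP.
  case: ifP => u1; last first.
    by rewrite mulr0 addr0; case: ifP.
  case: ifPn => u2; first by rewrite lerDl mulr1 powR_ge0.
  rewrite add0r mulr1 /ker -ltNge in u2 *.
  have u0 : (0 < `|u|)%R by rewrite (lt_trans _ u2).
  rewrite powRN -[leRHS]invrK lef_pV2 ?posrE ?invr_gt0 ?powR_gt0//.
  rewrite -powRN -[in leLHS](invrK 2%R) -powR_inv1 ?invr_ge0// -powRrM.
  rewrite mulN1r opprK ge0_ler_powR ?nnegrE ?(ltW al0) ?(ltW u2)//.
move: gj gfin ghalf gsplit.
move: (\int[lambda]_u (g 1%R u)%:E) => x gj; case: x gj => // x _ _ ghalf gsplit.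
have := le_trans gsplit (leeD2r _ ghalf).
rewrite -EFinM -EFinD !lee_fin => xle.
rewrite /C0 ler_pdivlMr//; lra.
Qed.

Lemma power_kernel_integral_le : exists2 C : R, (0 < C)%R &
  forall (m : R) (E : set R) (s : R), (0 < m)%R -> measurable E ->
    lambda E <= m%:E ->
    \int[lambda]_(t in E) (`|t - s| `^ (- al))%:E <= (C * m `^ (1 - al))%:E.
Proof.
have /andP[al0 al1] := al01.
exists (C0 + 1)%R; first by rewrite addr_gt0.
move=> m E s m0 mE Em.
have mpow : (m `^ (1 - al) = m * m `^ (- al))%R.
  by rewrite powRD ?(gt_eqF m0) ?implybT// powRr1// ltW.
have cutm : \int[lambda]_u (cut m u)%:E <= (C0 * m `^ (1 - al))%:E.
  rewrite (integral_scale m0 (measurable_cut m) (cut_ge0 m)).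
  rewrite mpow mulrCA EFinM.
  rewrite lee_pmul2l ?lte_fin//.
  apply: (@le_trans _ _ ((m `^ (- al))%:E * \int[lambda]_u (cut 1 u)%:E)).
    rewrite -(ge0_integralZl_fin lambda (powR_ge0 m (- al)) (measurable_cut 1)
      (cut_ge0 1)).
    apply: ge0_le_integral_fin.
    - apply: (measurableT_comp (measurable_cut _)).
      exact: measurable_funM.
    - by apply: measurable_funM => //; exact: measurable_cut.
    - by move=> u.
    move=> u; rewrite /cut (kerM u (ltW m0)).
    by rewrite normrM (gtr0_norm m0) ger_pMr//; case: ifP; rewrite ?mulr0.
  by rewrite mulrC EFinM lee_wpmul2l// lee_fin powR_ge0.
have mshift : measurable_fun setT (fun t : measurableTypeR R =>
    (- s + 1 * t)%R : measurableTypeR R).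
  by apply: measurable_funD => //; exact: measurable_funM.
rewrite integral_mkcond.
apply: (@le_trans _ _ (\int[lambda]_t ((cut m (- s + 1 * t))%:E +
    (m `^ (- al) * \1_E t)%:E))).
  apply: ge0_le_integral; first exact: measurableT.
  - by move=> t _; rewrite patchE; case: ifP => // _; rewrite lee_fin powR_ge0.
  - apply/(measurable_restrictT _ _).1 => //.
    apply: measurable_funTS; apply/measurable_EFinP.
    apply: (measurableT_comp measurable_ker).
    by apply: measurable_funB.
  - apply: emeasurable_funD; apply/measurable_EFinP.
      exact: (measurableT_comp (measurable_cut m) mshift).
    by apply: measurable_funM.
  move=> t _; rewrite patchE; case: ifPn => tE; last first.
    by rewrite -EFinD lee_fin addr_ge0// mulr_ge0 ?powR_ge0.
  rewrite -EFinD lee_fin indicE tE mulr1 mul1r /cut.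
  rewrite [(- s + t)%R]addrC.
  case: ifPn => ts; first by rewrite lerDl powR_ge0.
  rewrite add0r -ltNge in ts *.
  have ts0 : (0 < `|t - s|)%R by rewrite (lt_trans _ ts).
  rewrite !powRN lef_pV2 ?posrE ?powR_gt0//.
  by rewrite ge0_ler_powR ?nnegrE ?(ltW al0) ?(ltW ts) ?(ltW m0).
rewrite ge0_integralD//; last 4 first.
- by move=> t _; rewrite lee_fin.
- apply/measurable_EFinP.
  exact: (measurableT_comp (measurable_cut m) mshift).
- by move=> t _; rewrite lee_fin mulr_ge0 ?powR_ge0.
- by apply/measurable_EFinP; apply: measurable_funM.
rewrite mulrDl mul1r EFinD; apply: leeD.
  have := @ge0_integral_affine R 1%R (- s)%R (EFin \o cut m) (oner_neq0 _).
  move=> /(_ (iffRL (measurable_EFinP _ _) (measurable_cut m))) -> //.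
    by rewrite normr1 invr1 mul1e.
  by move=> z; rewrite lee_fin.
have mI : measurable_fun setT (\1_E : R -> R) by exact: measurable_indic.
rewrite (ge0_integralZl_fin lambda (powR_ge0 m (- al)) mI (fun=> ler0n _ _)).
rewrite integral_indic// setIT mpow.
by rewrite mulrC EFinM lee_wpmul2l// lee_fin powR_ge0.
Qed.

End power_kernel.

(** * The T T^* inequality and the bilinear estimate *)

Section tt_star.
Context d1 (Z : measurableType d1) d2 (T : measurableType d2) {R : realType}.
Variables (P : {sigma_finite_measure set Z -> \bar R})
  (L : {sigma_finite_measure set T -> \bar R}).

(* T T^* argument: duality against the averages of u, then a Cauchy-Schwarz
   inequality in which H^a and H^(2-a) are separated. *)
Lemma integral_tt_star_le (H : Z -> R) (u : T * Z -> R) (a : R) :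
  measurable_fun setT H -> (forall z, 0 <= H z)%R ->
  measurable_fun setT u -> (forall w, 0 <= u w)%R -> (a != 0)%R ->
  \int[L]_t \int[P]_z (H z * u (t, z))%:E <=
  (\int[P]_z (H z `^ a)%:E) `^ 2^-1 *
  (\int[L]_t \int[L]_s \int[P]_z
     (H z `^ (2 - a) * u (t, z) * u (s, z))%:E) `^ 2^-1.
Proof.
move=> mH H0 mu u0 a0.
have mu1 z : measurable_fun setT (fun t => u (t, z)).
  by apply: (measurableT_comp mu); exact: measurable_fun_pair.
have mu2 t : measurable_fun setT (fun z => u (t, z)).
  by apply: (measurableT_comp mu); exact: measurable_fun_pair.
pose G := (fun z => (H z) `^ (2 - a))%R.
have G0 z : (0 <= G z)%R by exact: powR_ge0.
have mG : measurable_fun setT G.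
  exact: (measurableT_comp (measurable_powR _) mH).
pose Phi z := \int[L]_t (u (t, z))%:E.
have Phi0 z : 0 <= Phi z by apply: integral_ge0 => t _; rewrite lee_fin.
have muE : measurable_fun setT (fun w : T * Z => (u w)%:E).
  exact/measurable_EFinP.
have mPhi : measurable_fun setT Phi.
  by apply: (@measurable_fun_fubini_tonelli_G _ _ T Z R L (fun w => (u w)%:E))
    => // w; rewrite lee_fin.
have GPhi0 z : 0 <= (G z)%:E * Phi z by rewrite mule_ge0// lee_fin.
have mGPhi : measurable_fun setT (fun z => (G z)%:E * Phi z).
  by apply: emeasurable_funM => //; exact/measurable_EFinP.
have mHu : measurable_fun setT (fun w : T * Z => (H w.2 * u w)%:E).
  apply/measurable_EFinP; apply: measurable_funM; last exact: mu.
  exact: (measurableT_comp mH measurable_snd).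
have Hu0 w : 0 <= (H w.2 * u w)%:E by rewrite lee_fin mulr_ge0.
(* H is split as H^(a/2) H^((2-a)/2): the first factor carries the norm of H, the second stays with
   [Phi]. *)
have HPhi z : (H z)%:E * Phi z =
    ((H z `^ a)%:E) `^ 2^-1 * ((G z)%:E * Phi z * Phi z) `^ (1 - 2^-1).
  have -> : (1 - 2^-1 = 2^-1 :> R)%R by field.
  rewrite -muleA poweRM ?mule_ge0 ?lee_fin// muleA; congr (_ * _).
    rewrite !poweR_EFin -EFinM -!powRrM -powRD; last first.
      apply/implyP => /eqP h; exfalso; move: h; rewrite -mulrDl addrC subrK.
      by rewrite mulfV// => /eqP; rewrite oner_eq0.
    by rewrite -mulrDl addrC subrK mulfV// powRr1.
  have h2 : (2^-1 + 2^-1 = 1 :> R)%R by field.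
  by rewrite poweRM// -ge0_poweRD ?h2 ?poweRe1 ?invr_ge0.
have -> : \int[L]_t \int[P]_z (H z * u (t, z))%:E = \int[P]_z ((H z)%:E * Phi z).
  have := @fubini_tonelli _ _ T Z R L P (fun w => (H w.2 * u w)%:E) mHu Hu0.
  move=> /= ->; apply: eq_integral => z _.
  by rewrite (ge0_integralZl_fin L (H0 z) (mu1 z) (fun=> u0 _)).
under eq_integral do rewrite HPhi.
have mHa : measurable_fun setT (fun z => (H z `^ a)%:E).
  apply/measurable_EFinP; exact: (measurableT_comp (measurable_powR _) mH).
apply: (le_trans (hoelder_poweR P _ mHa _ _ _)).
- by rewrite invr_ge0 ler0n invf_le1// ler1n.
- exact: emeasurable_funM.
- by move=> z; rewrite lee_fin powR_ge0.
- by move=> z; rewrite mule_ge0.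
rewrite lee_wpmul2l ?poweR_ge0// (_ : (1 - 2^-1 = 2^-1 :> R)%R); last by field.
apply: ge0_le_poweR; rewrite ?invr_ge0//.
  by apply: integral_ge0 => z _; rewrite mule_ge0.
have m3 : measurable_fun setT (fun w : T * Z => (G w.2)%:E * Phi w.2 * (u w)%:E).
  apply: emeasurable_funM => //.
  exact: (measurableT_comp mGPhi measurable_snd).
have := @fubini_tonelli _ _ T Z R L P
  (fun w => (G w.2)%:E * Phi w.2 * (u w)%:E) m3 (fun=> mule_ge0 (GPhi0 _) _).
have uE0 w : 0 <= (u w)%:E by rewrite lee_fin.
move=> /(_ (fun=> uE0 _)) /= E3.
rewrite le_eqVlt; apply/orP; left; apply/eqP.
(* The two factors [Phi] are unfolded one at a time, each by Tonelli, which turns the square into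
   the double time integral. *)
transitivity (\int[P]_z \int[L]_t ((G z)%:E * Phi z * (u (t, z))%:E)).
  apply: eq_integral => z _; rewrite ge0_integralZl//.
  exact/measurable_EFinP.
rewrite -E3; apply: eq_integral => t _.
have mw : measurable_fun setT
    (fun w : T * Z => (G w.2 * u (t, w.2) * u w)%:E).
  apply/measurable_EFinP; apply: measurable_funM; last exact: mu.
  apply: measurable_funM; first exact: (measurableT_comp mG measurable_snd).
  exact: (measurableT_comp (mu2 t) measurable_snd).
have w0 w : 0 <= (G w.2 * u (t, w.2) * u w)%:E.
  by rewrite lee_fin !mulr_ge0.
have := @fubini_tonelli _ _ T Z R L P _ mw w0; rewrite /= => ->.
apply: eq_integral => z _; rewrite muleAC -EFinM.
by rewrite (ge0_integralZl_fin L (mulr_ge0 (G0 z) (u0 _)) (mu1 z) (fun=> u0 _)).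
Qed.

End tt_star.

Section bilinear_estimate.
Context {R : realType} (n : nat).
Local Notation V := (Rn R n).
Local Notation mu := (@lebesgue_Rn R n).

(** Hoelder with weights a - 1 and 2 - a. The first factor has no H and is computed by the change of
    variables; the second is a geometric mean of H phi and H psi, split by Cauchy-Schwarz. For phi =
    rho^(a/(2-a) - 1) the power [a / (2 * a - 2)] of phi is rho^(a/(2-a)), so every integral on the
    right becomes S(t) or S(s). *)
Lemma transport_bilinear_le (H : V * V -> R) (phi psi : V -> R) (a t s : R) :
  measurable_fun setT H -> (forall z, 0 <= H z)%R ->
  measurable_fun setT phi -> (forall x, 0 <= phi x)%R ->
  measurable_fun setT psi -> (forall x, 0 <= psi x)%R ->
  (1 < a < 2)%R -> t != s ->
  \int[mu \x mu]_z (H z `^ (2 - a) * phi (affine_Rn t z.1 z.2) *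
     psi (affine_Rn s z.1 z.2))%:E <=
  ((`|t - s| ^- n)%:E * (\int[mu]_x (phi x `^ (a / (2 * a - 2)))%:E *
     \int[mu]_x (psi x `^ (a / (2 * a - 2)))%:E)) `^ (a - 1) *
  ((\int[mu \x mu]_z (H z * phi (affine_Rn t z.1 z.2))%:E) `^ 2^-1 *
   (\int[mu \x mu]_z (H z * psi (affine_Rn s z.1 z.2))%:E) `^ 2^-1) `^ (2 - a).
Proof.
move=> mH H0 mphi phi0 mpsi psi0 /andP[a1 a2] ts.
have mshift r : measurable_fun setT (fun z : V * V => affine_Rn r z.1 z.2).
  exact: measurable_affine_Rn.
pose f z := phi (affine_Rn t z.1 z.2).
pose g z := psi (affine_Rn s z.1 z.2).
have mf : measurable_fun setT f by exact: (measurableT_comp mphi).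
have mg : measurable_fun setT g by exact: (measurableT_comp mpsi).
have f0 z : (0 <= f z)%R by exact: phi0.
have g0 z : (0 <= g z)%R by exact: psi0.
pose r := (a / (2 * a - 2))%R.
have r0 : (0 < r)%R by rewrite divr_gt0//; lra.
(* The two factors must together contain phi to the power one; this fixes [r]. *)
have rE : (r * (a - 1) + 2^-1 * (2 - a) = 1)%R.
  by rewrite /r; field; apply/eqP; lra.
have split_pow x : (0 <= x)%R ->
    x = ((x `^ r) `^ (a - 1) * (x `^ 2^-1) `^ (2 - a))%R.
  move=> x0; rewrite -!powRrM -powRD ?rE ?powRr1//.
  by rewrite oner_eq0.
pose A z := (f z `^ r)%:E * (g z `^ r)%:E.
pose B z := ((H z * f z)%:E) `^ 2^-1 * ((H z * g z)%:E) `^ (1 - 2^-1).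
have half : (1 - 2^-1 = 2^-1 :> R)%R by field.
have h2 : (2^-1 + 2^-1 = 1 :> R)%R by field.
have mfr : measurable_fun setT (fun z => (f z `^ r)%:E).
  apply/measurable_EFinP; exact: (measurableT_comp (measurable_powR _) mf).
have mgr : measurable_fun setT (fun z => (g z `^ r)%:E).
  apply/measurable_EFinP; exact: (measurableT_comp (measurable_powR _) mg).
have mA : measurable_fun setT A by exact: emeasurable_funM.
have mHf : measurable_fun setT (fun z => (H z * f z)%:E).
  by apply/measurable_EFinP; exact: measurable_funM.
have mHg : measurable_fun setT (fun z => (H z * g z)%:E).
  by apply/measurable_EFinP; exact: measurable_funM.
have mB : measurable_fun setT B.
  by apply: emeasurable_funM; exact: measurableT_comp_poweR.
have A0 z : 0 <= A z by rewrite mule_ge0// lee_fin powR_ge0.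
have B0 z : 0 <= B z by rewrite mule_ge0// poweR_ge0.
have AB z : (H z `^ (2 - a) * f z * g z)%:E =
    A z `^ (a - 1) * B z `^ (1 - (a - 1)).
  have -> : (1 - (a - 1) = 2 - a)%R by ring.
  have -> : A z = (f z `^ r * g z `^ r)%:E by [].
  have -> : B z = ((H z * f z) `^ 2^-1 * (H z * g z) `^ 2^-1)%:E.
    by rewrite /B half.
  rewrite !poweR_EFin -EFinM; congr EFin.
  have hH : ((H z `^ 2^-1) `^ (2 - a) * (H z `^ 2^-1) `^ (2 - a) =
      H z `^ (2 - a))%R.
    rewrite -powRM ?powR_ge0// -powRD; last by rewrite h2 oner_eq0.
    by rewrite h2 powRr1.
  rewrite -hH {1}(split_pow _ (f0 z)) {1}(split_pow _ (g0 z)).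
  rewrite (powRM _ (powR_ge0 _ _) (powR_ge0 _ _)).
  rewrite (powRM _ (H0 z) (f0 z)) (powRM _ (H0 z) (g0 z)).
  rewrite (powRM _ (mulr_ge0 (powR_ge0 _ _) (powR_ge0 _ _))
    (mulr_ge0 (powR_ge0 _ _) (powR_ge0 _ _))).
  rewrite !(powRM _ (powR_ge0 _ _) (powR_ge0 _ _)).
  move: (_ `^ _ `^ _)%R (_ `^ _ `^ _)%R (_ `^ _ `^ _)%R (_ `^ _ `^ _)%R
    (_ `^ _ `^ _)%R => x1 x2 x3 x4 x5.
  ring.
have -> : \int[mu \x mu]_z (H z `^ (2 - a) * phi (affine_Rn t z.1 z.2) *
     psi (affine_Rn s z.1 z.2))%:E =
    \int[mu \x mu]_z (A z `^ (a - 1) * B z `^ (1 - (a - 1))).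
  by apply: eq_integral => z _; rewrite -AB.
have a01 : (0 <= a - 1 <= 1)%R by lra.
apply: (le_trans (hoelder_poweR (mu \x mu) a01 mA mB A0 B0)).
have IA : \int[mu \x mu]_z A z = (`|t - s| ^- n)%:E *
    (\int[mu]_x (phi x `^ r)%:E * \int[mu]_x (psi x `^ r)%:E).
  have mphir : measurable_fun setT (fun x => (phi x `^ r)%:E).
    apply/measurable_EFinP; exact: (measurableT_comp (measurable_powR _) mphi).
  have mpsir : measurable_fun setT (fun x => (psi x `^ r)%:E).
    apply/measurable_EFinP; exact: (measurableT_comp (measurable_powR _) mpsi).
  have pos (h : V -> R) x : 0 <= (h x `^ r)%:E by rewrite lee_fin powR_ge0.
  have := ge0_integral_transport2 ts mphir (pos phi) mpsir (pos psi) => <-.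
  exact: (@fubini_tonelli1 _ _ V V R mu mu A mA A0).
have IB : \int[mu \x mu]_z B z <=
    (\int[mu \x mu]_z (H z * f z)%:E) `^ 2^-1 *
    (\int[mu \x mu]_z (H z * g z)%:E) `^ (1 - 2^-1).
  apply: hoelder_poweR => //.
  - by lra.
  - by move=> z; rewrite lee_fin mulr_ge0.
  - by move=> z; rewrite lee_fin mulr_ge0.
rewrite half in IB.
rewrite -/r IA lee_wpmul2l ?poweR_ge0//.
rewrite (_ : (1 - (a - 1) = 2 - a)%R); last by ring.
apply: ge0_le_poweR => //; first by lra.
by apply: integral_ge0 => z _.
Qed.

End bilinear_estimate.

Section sigma_finite_product.
Context d1 d2 (T1 : measurableType d1) (T2 : measurableType d2) {R : realType}.
Variables (m1 : {sigma_finite_measure set T1 -> \bar R})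
  (m2 : {sigma_finite_measure set T2 -> \bar R}).

Lemma sigma_finite_product_measure1 : sigma_finite setT (m1 \x m2).
Proof.
have /sigma_finiteP[F [TF ndF Foo]] := sigma_finiteT m1.
have /sigma_finiteP[G [TG ndG Goo]] := sigma_finiteT m2.
exists (fun k => F k `*` G k) => [|k].
  apply/esym; rewrite -subTset => -[x y] _.
  have [i _ Fix] : (\bigcup_i F i) x by rewrite -TF.
  have [j _ Gjy] : (\bigcup_i G i) y by rewrite -TG.
  exists (maxn i j) => //; split.
  - by move: Fix; exact/subsetPset/ndF/leq_maxl.
  - by move: Gjy; exact/subsetPset/ndG/leq_maxr.
have [mF Fk] := Foo k; have [mG Gk] := Goo k.
split; first exact: measurableX.
by rewrite product_measure1E// lte_mul_pinfty// ge0_fin_numE.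
Qed.

(* The library attaches this structure to probability measures only. *)
Definition sigma_finite_product :
    {sigma_finite_measure set (T1 * T2)%type -> \bar R} :=
  HB.pack (m1 \x m2) (Measure_isSigmaFinite.Build _ _ _ (m1 \x m2)
    sigma_finite_product_measure1).

End sigma_finite_product.

(** The weight S^(-a/2) is the one that cancels S(t) and S(s) in the bilinear bound: -a/2 + (a - 1)
    + (2 - a)/2 = 0. Only the time kernel remains. *)
Lemma powR_tt_star (R : realType) (n : nat) (a x y d : R) :
  (0 < x -> 0 < y -> 0 < d ->
  x `^ (- (a / 2)) * y `^ (- (a / 2)) *
    ((d ^- n * (x * y)) `^ (a - 1) * (x `^ 2^-1 * y `^ 2^-1) `^ (2 - a)) =
  d `^ (- (n%:R * (a - 1))))%R.
Proof.
move=> x0 y0 d0.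
have pw z : (0 < z)%R -> (z `^ (- (a / 2)) * z `^ (a - 1) *
    z `^ (2^-1 * (2 - a)) = 1)%R.
  move=> z0; rewrite -(powRD (r := (- (a / 2))%R)) ?(gt_eqF z0) ?implybT//.
  rewrite -powRD ?(gt_eqF z0) ?implybT//.
  rewrite (_ : (- (a / 2) + (a - 1) + 2^-1 * (2 - a) = 0)%R) ?powRr0//.
  by field.
rewrite -(powR_invn n (ltW d0)).
rewrite (powRM _ (powR_ge0 _ _) (mulr_ge0 (ltW x0) (ltW y0))).
rewrite (powRM _ (ltW x0) (ltW y0)) (powRM _ (powR_ge0 _ _) (powR_ge0 _ _)).
rewrite -(powRrM d) -(powRrM x) -(powRrM y) mulNr.
have := pw x x0; have := pw y y0.
move: (x `^ _)%R (x `^ _)%R (x `^ _)%R (y `^ _)%R (y `^ _)%R (y `^ _)%R.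
move=> x1 x2 x3 y1 y2 y3 hy hx; move: (d `^ _)%R => d1.
transitivity ((x3 * x2 * x1) * (y3 * y2 * y1) * d1)%R; first by ring.
by rewrite hx hy !mul1r.
Qed.

(** * The Strichartz estimate on one level set, assuming finiteness *)

Section strichartz.
Context {R : realType} (n : nat).
Local Notation V := (Rn R n).
Local Notation mu := (@lebesgue_Rn R n).
Local Notation lambda := (@lebesgue_measure R).

Definition vavg_pow (H : V * V -> R) (r t : R) : \bar R :=
  \int[mu]_x (vavg H t x) `^ r.

Lemma measurable_vavg_pow (H : V * V -> R) (r : R) :
  measurable_fun setT H -> (forall z, 0 <= H z)%R ->
  measurable_fun setT (vavg_pow H r).
Proof.
move=> mH H0.
apply: (@measurable_fun_fubini_tonelli_F _ _ R V R mu
  (fun z => (vavg H z.1 z.2) `^ r)).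
  by apply: measurableT_comp_poweR; exact: measurable_vavg2.
by move=> z; exact: poweR_ge0.
Qed.

Lemma vavg_pow_ge0 (H : V * V -> R) (r t : R) : 0 <= vavg_pow H r t.
Proof. by apply: integral_ge0 => x _; exact: poweR_ge0. Qed.

(** Averaging is the adjoint of phi |-> phi(x + t v): conservation of mass applied to H(x - t v, v)
    phi(x). *)
Lemma ge0_integral_transport_vavg (H : V * V -> R) (phi : V -> R) (t : R) :
  measurable_fun setT H -> (forall z, 0 <= H z)%R ->
  measurable_fun setT phi -> (forall x, 0 <= phi x)%R ->
  \int[mu \x mu]_z (H z * phi (affine_Rn t z.1 z.2))%:E =
  \int[mu]_x (vavg H t x * (phi x)%:E).
Proof.
move=> mH H0 mphi phi0.
have mshift r : measurable_fun setT (fun z : V * V => affine_Rn r z.1 z.2).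
  exact: measurable_affine_Rn.
have mf : measurable_fun setT
    (fun z : V * V => (H z * phi (affine_Rn t z.1 z.2))%:E).
  apply/measurable_EFinP; apply: measurable_funM; first exact: mH.
  exact: (measurableT_comp mphi).
have f0 (z : V * V) : 0 <= (H z * phi (affine_Rn t z.1 z.2))%:E.
  by rewrite lee_fin mulr_ge0.
apply: (etrans (@fubini_tonelli1 _ _ V V R mu mu _ mf f0)); rewrite /fubini_F.
pose g z := (H (affine_Rn (- t) z.1 z.2, z.2) * phi z.1)%:E.
have mg : measurable_fun setT g.
  apply/measurable_EFinP; apply: measurable_funM.
    exact: measurable_comp_transport.
  exact: (measurableT_comp mphi measurable_fst).
have g0 z : 0 <= g z by rewrite lee_fin mulr_ge0.
transitivity (\int[mu]_x \int[mu]_v g (affine_Rn t x v, v)).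
  apply: eq_integral => x _; apply: eq_integral => v _.
  by rewrite /g/= affine_RnD subrr affine_Rn0.
apply: (etrans (ge0_integral_transport t mg g0)).
apply: eq_integral => x _; rewrite /g/= /vavg.
under eq_integral do rewrite EFinM.
rewrite ge0_integralZr ?lee_fin//.
  apply/measurable_EFinP.
  exact: (measurableT_comp_transport (a := fun=> (- t)%R) (x := fun=> x) mH).
by move=> v _; rewrite lee_fin.
Qed.

Section bounded.
Variables (a C A : R) (H : V * V -> R).
Local Notation al := (n%:R * (a - 1))%R.
Local Notation r := (a / (2 - a))%R.
Hypothesis a12 : (1 < a < 2)%R.
Hypothesis C0 : (0 < C)%R.
Hypothesis kernel : forall (m : R) (E : set R) (s : R), (0 < m)%R ->
  measurable E -> lambda E <= m%:E ->
  \int[lambda]_(t in E) (`|t - s| `^ (- al))%:E <= (C * m `^ (1 - al))%:E.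
Hypothesis mH : measurable_fun setT H.
Hypothesis H0 : forall z, (0 <= H z)%R.
Hypothesis HA : \int[mu \x mu]_z (H z `^ a)%:E <= A%:E.
Hypothesis vavg_fin : forall t x, vavg H t x < +oo.
Hypothesis vavg_pow_fin : forall t, vavg_pow H r t < +oo.

Let rho t x : R := fine (vavg H t x).

Let rhoE t x : vavg H t x = (rho t x)%:E.
Proof. by rewrite fineK// ge0_fin_numE ?vavg_fin// vavg_ge0. Qed.

Let rho_ge0 t x : (0 <= rho t x)%R.
Proof. by rewrite fine_ge0// vavg_ge0. Qed.

Let mrho : measurable_fun setT (fun z : R * V => rho z.1 z.2).
Proof.
apply: (measurableT_comp (@fine_measurable _ setT measurableT)).
exact: measurable_vavg2.
Qed.

(** S(t) as a real number. The argument uses negative powers of it, hence the finiteness hypotheses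
    above, which truncated data satisfy. *)
Let s t : R := fine (vavg_pow H r t).

Let sE t : vavg_pow H r t = (s t)%:E.
Proof. by rewrite fineK// ge0_fin_numE ?vavg_pow_fin// vavg_pow_ge0. Qed.

(** The function dual to rho in L^r: paired with rho it gives S(t), and so does the power of it that
    occurs in the bilinear estimate. *)
Let phi t x : R := (rho t x `^ (r - 1))%R.

Let phi_ge0 t x : (0 <= phi t x)%R.
Proof. exact: powR_ge0. Qed.

Let mphi2 : measurable_fun setT (fun z : R * V => phi z.1 z.2).
Proof. exact: (measurableT_comp (measurable_powR _) mrho). Qed.

Let mphi t : measurable_fun setT (phi t).
Proof.
apply: (@measurableT_comp _ _ _ _ _ _ (fun z : R * V => phi z.1 z.2) _
  (fun x => (t, x))) => //.
exact: measurable_fun_pair.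
Qed.

Let r_gt1 : (1 < r)%R.
Proof. by case/andP: a12 => a1 a2; rewrite ltr_pdivlMr; lra. Qed.

Let integral_phi t :
  \int[mu]_x (phi t x `^ (a / (2 * a - 2)))%:E = (s t)%:E.
Proof.
case/andP: a12 => a1 a2.
rewrite -sE; apply: eq_integral => x _; rewrite rhoE /phi -powRrM.
congr (_ `^ _)%:E; field; apply/andP; split; apply/eqP; lra.
Qed.

Let integral_Hphi t :
  \int[mu \x mu]_z (H z * phi t (affine_Rn t z.1 z.2))%:E = (s t)%:E.
Proof.
rewrite -sE (ge0_integral_transport_vavg t mH H0 (mphi t) (phi_ge0 t)).
apply: eq_integral => x _.
rewrite rhoE -EFinM /phi poweR_EFin mulr_powRB1//.
by rewrite (lt_trans _ r_gt1).
Qed.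

Variables (E : set R) (m sigma : R).
Hypothesis mE : measurable E.
Hypothesis Em : lambda E = m%:E.
Hypothesis m0 : (0 < m)%R.
Hypothesis sigma0 : (0 < sigma)%R.
Hypothesis E_sigma : forall t, E t -> sigma%:E < vavg_pow H r t.

Let s_gt t : E t -> (sigma < s t)%R.
Proof. by move=> /E_sigma; rewrite sE lte_fin. Qed.

Let w t : R := if t \in E then (s t `^ (- (a / 2)))%R else 0%R.

Let w_ge0 t : (0 <= w t)%R.
Proof. by rewrite /w; case: ifP => // _; exact: powR_ge0. Qed.

Let mw : measurable_fun setT w.
Proof.
apply: measurable_fun_ifT => //.
  apply: (measurable_fun_bool true); rewrite setTI (_ : _ @^-1` _ = E)//.
  by apply/seteqP; split=> t /=; [move/set_mem|move/mem_set].
apply: (measurableT_comp (measurable_powR _)).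
apply: (measurableT_comp (@fine_measurable _ setT measurableT)).
exact: measurable_vavg_pow.
Qed.

Let u (z : R * (V * V)) : R := (w z.1 * phi z.1 (affine_Rn z.1 z.2.1 z.2.2))%R.

Let u_ge0 z : (0 <= u z)%R. Proof. by rewrite mulr_ge0. Qed.

Let m_u : measurable_fun setT u.
Proof.
apply: measurable_funM; first exact: (measurableT_comp mw measurable_fst).
apply: (@measurableT_comp _ _ _ _ _ _ (fun z : R * V => phi z.1 z.2) _
  (fun z : R * (V * V) => (z.1, affine_Rn z.1 z.2.1 z.2.2))) => //.
apply: measurable_fun_pair => //; apply: measurable_affine_Rn => //.
  exact: (measurableT_comp measurable_fst measurable_snd).
exact: (measurableT_comp measurable_snd measurable_snd).
Qed.

(** At each time in E the inner integral equals S^(-a/2) S, and 1 - a/2 is positive, so it is at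
    least its value at S = sigma. *)
Let lower : (sigma `^ (1 - a / 2) * m)%:E <=
  \int[lambda]_t \int[mu \x mu]_z (H z * u (t, z))%:E.
Proof.
case/andP: a12 => a1 a2.
have IE t : \int[mu \x mu]_z (H z * u (t, z))%:E = (w t * s t)%:E.
  rewrite EFinM -integral_Hphi.
  have mf : measurable_fun setT
      (fun z : V * V => H z * phi t (affine_Rn t z.1 z.2))%R.
    apply: measurable_funM; first exact: mH.
    by apply: (measurableT_comp (mphi t)); exact: measurable_affine_Rn.
  have f0 (z : V * V) : (0 <= H z * phi t (affine_Rn t z.1 z.2))%R.
    by rewrite mulr_ge0.
  rewrite -(ge0_integralZl_fin (mu \x mu) (w_ge0 t) mf f0).
  by apply: eq_integral => z _; rewrite /u/= mulrCA.
under eq_integral do rewrite IE.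
have mI : measurable_fun setT (\1_E : R -> R) by exact: measurable_indic.
rewrite EFinM -Em -[E in lambda E]setIT -integral_indic//.
rewrite -(ge0_integralZl_fin lambda (powR_ge0 sigma (1 - a / 2)) mI
  (fun=> ler0n _ _)).
apply: ge0_le_integral_fin.
- by apply: measurable_funM.
- apply: measurable_funM => //.
  apply: (measurableT_comp (@fine_measurable _ setT measurableT)).
  exact: measurable_vavg_pow.
- by move=> t; rewrite mulr_ge0 ?powR_ge0.
move=> t; rewrite indicE /w; case: ifPn => tE; last by rewrite mulr0 mul0r.
have st : (sigma < s t)%R by apply: s_gt; exact/set_mem.
have s0 : (0 < s t)%R by rewrite (lt_trans sigma0).
rewrite mulr1 -{2}(powRr1 (ltW s0)) -powRD; last first.
  by rewrite (gt_eqF s0) implybT.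
rewrite [(- (a / 2) + 1)%R]addrC ge0_ler_powR ?nnegrE ?(ltW sigma0) ?(ltW s0)//.
  by rewrite subr_ge0 ler_pdivrMr//; lra.
exact: ltW.
Qed.

Let X t t' : \bar R :=
  \int[mu \x mu]_z (H z `^ (2 - a) * u (t, z) * u (t', z))%:E.

Let X_ge0 t t' : 0 <= X t t'.
Proof.
by apply: integral_ge0 => z _; rewrite lee_fin !mulr_ge0// powR_ge0.
Qed.

Let mX : measurable_fun setT (fun z : R * R => X z.1 z.2).
Proof.
have := @measurable_fun_fubini_tonelli_F _ _ (R * R)%type (V * V)%type R
  (sigma_finite_product mu mu) (fun z => (H z.2 `^ (2 - a) * u (z.1.1, z.2) *
    u (z.1.2, z.2))%:E).
apply; last by move=> z; rewrite lee_fin !mulr_ge0// powR_ge0.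
have mH2 : measurable_fun setT (fun z => H z `^ (2 - a))%R.
  exact: (measurableT_comp (measurable_powR _) mH).
apply/measurable_EFinP; apply: measurable_funM; first apply: measurable_funM.
- exact: (measurableT_comp mH2 measurable_snd).
- apply: (measurableT_comp m_u); apply: measurable_fun_pair => //.
  exact: (measurableT_comp measurable_fst measurable_fst).
- apply: (measurableT_comp m_u); apply: measurable_fun_pair => //.
  exact: (measurableT_comp measurable_snd measurable_fst).
Qed.

Let X_le t t' : t \in E -> t' \in E -> t' != t ->
  X t t' <= (`|t' - t| `^ (- al))%:E.
Proof.
case/andP: a12 => a1 a2 tE t'E tt'.
have st0 : (0 < s t)%R := lt_trans sigma0 (s_gt (set_mem tE)).
have st'0 : (0 < s t')%R := lt_trans sigma0 (s_gt (set_mem t'E)).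
pose f (z : V * V) := (H z `^ (2 - a) * phi t (affine_Rn t z.1 z.2) *
  phi t' (affine_Rn t' z.1 z.2))%R.
have mf : measurable_fun setT f.
  apply: measurable_funM; first apply: measurable_funM.
  - exact: (measurableT_comp (measurable_powR _) mH).
  - by apply: (measurableT_comp (mphi t)); exact: measurable_affine_Rn.
  - by apply: (measurableT_comp (mphi t')); exact: measurable_affine_Rn.
have f0 z : (0 <= f z)%R by rewrite !mulr_ge0// powR_ge0.
have -> : X t t' = (w t * w t')%:E * \int[mu \x mu]_z (f z)%:E.
  rewrite -(ge0_integralZl_fin (mu \x mu) (mulr_ge0 (w_ge0 t) (w_ge0 t')) mf f0).
  apply: eq_integral => z _; congr EFin; rewrite /u /f/=.
  move: (H z `^ (2 - a))%R (phi t _) (phi t' _) (w t) (w t') => y1 y2 y3 y4 y5.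
  by ring.
have tt : t != t' by rewrite eq_sym.
have le_subst (x l p p' q q' y y' z z' : \bar R) :
    p = p' -> q = q' -> y = y' -> z = z' ->
    x <= (l * (p * q)) `^ (a - 1) * (y `^ 2^-1 * z `^ 2^-1) `^ (2 - a) ->
    x <= (l * (p' * q')) `^ (a - 1) * (y' `^ 2^-1 * z' `^ 2^-1) `^ (2 - a).
  by move=> -> -> -> ->.
have fle := le_subst _ _ _ _ _ _ _ _ _ _ (integral_phi t) (integral_phi t')
  (integral_Hphi t) (integral_Hphi t') (transport_bilinear_le mH H0 (mphi t)
  (phi_ge0 t) (mphi t') (phi_ge0 t') a12 tt).
have ww0 : 0 <= (w t * w t')%:E by rewrite lee_fin mulr_ge0.
apply: (le_trans (lee_wpmul2l ww0 fle)).
rewrite -[leLHS]/(((w t * w t') * ((`|t - t'| ^- n * (s t * s t')) `^ (a - 1) *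
  (s t `^ 2^-1 * s t' `^ 2^-1) `^ (2 - a)))%:E) lee_fin /w tE t'E.
have d0 : (0 < `|t' - t|)%R by rewrite normr_gt0 subr_eq0.
rewrite distrC le_eqVlt; apply/orP; left; apply/eqP.
exact: (powR_tt_star n a st0 st'0 d0).
Qed.

(** [X] vanishes unless both times lie in E. The inner integral is bounded by the kernel estimate
    uniformly in t, and the outer one adds the factor m. *)
Let upper : \int[lambda]_t \int[lambda]_t' X t t' <=
  (C * m `^ (1 - al) * m)%:E.
Proof.
have K0 : (0 <= C * m `^ (1 - al))%R by rewrite mulr_ge0 ?powR_ge0// ltW.
have mI : measurable_fun setT (\1_E : R -> R) by exact: measurable_indic.
rewrite [leRHS]EFinM -Em -[E in lambda E]setIT -integral_indic//.
rewrite -(ge0_integralZl_fin lambda K0 mI (fun=> ler0n _ _)).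
apply: ge0_le_integral; first exact: measurableT.
- by move=> t _; apply: integral_ge0 => t' _.
- have := @measurable_fun_fubini_tonelli_F _ _ (measurableTypeR R)
    (measurableTypeR R) R lambda (fun z => X z.1 z.2).
  by apply => // z.
- by apply/measurable_EFinP; exact: measurable_funM.
move=> t _; rewrite indicE; case: (boolP (t \in E)) => tE; last first.
  rewrite mulr0; under eq_integral => t' _.
    rewrite (_ : X t t' = 0); last first.
      rewrite /X; under eq_integral do
        rewrite /u/= /w (negbTE tE) mul0r mulr0 mul0r.
      exact: integral0.
    over.
  by rewrite integral0.
rewrite mulr1; apply: le_trans (kernel t m0 mE _); last by rewrite Em.
rewrite [leRHS]integral_mkcond.
have mXt : measurable_fun setT (X t).
  apply: (@measurableT_comp _ _ _ _ _ _ (fun z : R * R => X z.1 z.2) _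
    (fun t' => (t, t'))) => //.
  exact: measurable_fun_pair.
apply: ae_ge0_le_integral; first exact: measurableT.
- by move=> t' _.
- exact: mXt.
- by move=> t' _; rewrite patchE; case: ifP => // _; rewrite lee_fin powR_ge0.
- apply/(measurable_restrictT _ _).1 => //; apply: measurable_funTS.
  apply/measurable_EFinP; apply: (measurableT_comp (measurable_powR _)).
  apply: (measurableT_comp (@normr_measurable _ setT)).
  exact: measurable_funB.
(* The pointwise bound [X_le] holds off the diagonal only; for fixed t this excludes a single
   point. *)
exists [set t]; split => //; first exact: lebesgue_measure_set1.
move=> t' /= nle; apply: contrapT => /eqP t't; apply: nle => _.
rewrite patchE; case: ifPn => t'E; first exact: X_le.
rewrite /X; under eq_integral do rewrite /u/= [w t']/w (negbTE t'E) mul0r mulr0.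
by rewrite integral0.
Qed.

Lemma strichartz_bounded : (sigma `^ (1 - a / 2) * m <=
  A `^ 2^-1 * (C * m `^ (1 - al) * m) `^ 2^-1)%R.
Proof.
case/andP: a12 => a1 a2.
rewrite -lee_fin; apply: (le_trans lower).
have a0 : a != 0%R by apply/eqP; lra.
apply: (le_trans (integral_tt_star_le (sigma_finite_product mu mu) lambda mH H0
  m_u u_ge0 a0)).
rewrite EFinM; apply: lee_pmul; rewrite ?poweR_ge0//.
  rewrite -poweR_EFin; apply: ge0_le_poweR => //.
  by apply: integral_ge0 => z _; rewrite lee_fin powR_ge0.
rewrite -poweR_EFin; apply: ge0_le_poweR; first by rewrite invr_ge0.
  apply: integral_ge0 => t _; apply: integral_ge0 => t' _.
  exact: (X_ge0 t t').
exact: upper.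
Qed.

End bounded.

End strichartz.

(** Squaring the hypothesis gives sigma^(2-a) m^2 <= A C m^(2-al). Since m is finite and positive,
    m^(2-al) can be cancelled, which leaves a bound on m^al. *)
Lemma powR_weak_type_bound (R : realType) (a al A C sigma m : R) :
  (0 < al -> 0 <= A -> 0 < C -> 0 < sigma -> 0 < m ->
  sigma `^ (1 - a / 2) * m <= A `^ 2^-1 * (C * m `^ (1 - al) * m) `^ 2^-1 ->
  m <= (C * (A * sigma `^ (a - 2))) `^ al^-1)%R.
Proof.
move=> al0 A0 C0 s0 m0 h.
have X0 : (0 <= C * m `^ (1 - al) * m)%R.
  by rewrite !mulr_ge0 ?powR_ge0// ltW.
have half : (2^-1 + 2^-1 = 1 :> R)%R by field.
have sq (x : R) : (0 <= x)%R -> (x `^ 2^-1 * x `^ 2^-1 = x)%R.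
  move=> x0; rewrite -powRD; last by rewrite half oner_eq0.
  by rewrite half powRr1.
have mE : (m = m `^ (1 - al) * m `^ al)%R.
  rewrite -powRD; last by rewrite subrK oner_eq0.
  by rewrite subrK powRr1// ltW.
have sE : (sigma `^ (1 - a / 2) * sigma `^ (1 - a / 2) * sigma `^ (a - 2) = 1)%R.
  rewrite -!powRD ?(gt_eqF s0) ?implybT//.
  by rewrite (_ : (_ + _)%R = 0%R) ?powRr0//; field.
have := ler_pM (mulr_ge0 (powR_ge0 _ _) (ltW m0))
  (mulr_ge0 (powR_ge0 _ _) (ltW m0)) h h.
rewrite [leRHS]mulrACA (sq _ A0) (sq _ X0) => {}h.
have {}h : (sigma `^ (1 - a / 2) * sigma `^ (1 - a / 2) * m <=
    A * C * m `^ (1 - al))%R.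
  rewrite -(ler_pM2r m0); apply: le_trans (le_trans h _); rewrite le_eqVlt;
    apply/orP; left; apply/eqP; ring.
have p0 : (0 < m `^ (1 - al))%R by rewrite powR_gt0.
have {}h : (sigma `^ (1 - a / 2) * sigma `^ (1 - a / 2) * m `^ al <= A * C)%R.
  rewrite -(ler_pM2r p0); apply: le_trans h.
  rewrite le_eqVlt; apply/orP; left; apply/eqP; rewrite [in RHS]mE.
  by ring.
have {}h : (m `^ al <= C * (A * sigma `^ (a - 2)))%R.
  have s'0 : (0 <= sigma `^ (a - 2))%R by exact: powR_ge0.
  have := ler_wpM2r s'0 h.
  have -> : (A * C * sigma `^ (a - 2) = C * (A * sigma `^ (a - 2)))%R by ring.
  apply: le_trans; rewrite le_eqVlt; apply/orP; left; apply/eqP.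
  by rewrite mulrAC sE mul1r.
have mK : (m = (m `^ al) `^ al^-1)%R.
  by rewrite -powRrM divff ?lt0r_neq0// powRr1// ltW.
rewrite [leLHS]mK.
apply: ge0_ler_powR => //.
- by rewrite invr_ge0 ltW.
- by rewrite nnegrE powR_ge0.
- by rewrite nnegrE !mulr_ge0 ?powR_ge0// ltW.
Qed.

(** * Truncation to bounded data with support in a product of sets of finite measure *)

Section truncation.
Context {R : realType} (n : nat).
Local Notation V := (Rn R n).
Local Notation mu := (@lebesgue_Rn R n).
Local Notation lambda := (@lebesgue_measure R).
Variables (H : V * V -> R) (F : (set V)^nat).
Hypothesis mH : measurable_fun setT H.
Hypothesis H0 : forall z, (0 <= H z)%R.
Hypothesis FT : setT = \bigcup_k F k.
Hypothesis ndF : nondecreasing_seq F.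
Hypothesis mF : forall k, measurable (F k).
Hypothesis Foo : forall k, mu (F k) < +oo.

(** The bound on H and on the velocities makes the averages bounded; the bound on positions as well
    makes the total mass finite. *)
Let Z k := [set z | (H z <= k%:R)%R] `&` (F k `*` F k).

Let mZ k : measurable (Z k).
Proof.
apply: measurableI; last exact: measurableX.
rewrite -[X in measurable X]setTI.
exact: (measurable_fun_ler mH (measurable_cst (k%:R : R))).
Qed.

Let ndZ : nondecreasing_seq Z.
Proof.
move=> i j ij; apply/subsetPset => z [/= Hz [Fz1 Fz2]]; split.
  by rewrite /= (le_trans Hz)// ler_nat.
by split; [move: Fz1|move: Fz2]; exact/subsetPset/ndF.
Qed.

Let Zcover z : exists k, Z k z.
Proof.
have [i _ Fi] : (\bigcup_k F k) z.1 by rewrite -FT.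
have [j _ Fj] : (\bigcup_k F k) z.2 by rewrite -FT.
exists (maxn (Num.truncn (H z)).+1 (maxn i j)); split.
  rewrite /= (@le_trans _ _ (Num.truncn (H z)).+1%:R)//.
    by rewrite ltW// -truncn_lt_nat.
  by rewrite ler_nat leq_maxl.
have ndF' l l' : (l <= l')%N -> F l `<=` F l' by move=> ?; exact/subsetPset/ndF.
split.
  by apply: ndF' Fi; rewrite leq_max leq_maxl orbT.
by apply: ndF' Fj; rewrite leq_max leq_maxr orbT.
Qed.

Definition trunc (k : nat) (z : V * V) : R := if z \in Z k then H z else 0%R.

Lemma trunc_ge0 k z : (0 <= trunc k z)%R.
Proof. by rewrite /trunc; case: ifP. Qed.

Lemma trunc_le k z : (trunc k z <= H z)%R.
Proof. by rewrite /trunc; case: ifP. Qed.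

Lemma measurable_trunc k : measurable_fun setT (trunc k).
Proof.
apply: measurable_fun_ifT => //.
apply: (measurable_fun_bool true); rewrite setTI (_ : _ @^-1` _ = Z k)//.
by apply/seteqP; split=> z /=; [move/set_mem|move/mem_set].
Qed.

Lemma trunc_homo i j z : (i <= j)%N -> (trunc i z <= trunc j z)%R.
Proof.
move=> ij; rewrite /trunc; case: ifPn => zi; last by case: ifP.
by rewrite mem_set//; move: (set_mem zi); exact/subsetPset/ndZ.
Qed.

Let muF k : mu (F k) = (fine (mu (F k)))%:E.
Proof. by rewrite fineK// ge0_fin_numE. Qed.

Let mF1 k : measurable_fun setT (\1_(F k) : V -> R).
Proof. exact: measurable_indic. Qed.

Let trunc_indic k z : (trunc k z <= k%:R * \1_(F k) z.1 * \1_(F k) z.2)%R.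
Proof.
rewrite /trunc; case: ifPn => [/set_mem[/= Hz [F1 F2]]|_].
  by rewrite !indicE !mem_set// !mulr1.
by rewrite !mulr_ge0// indicE.
Qed.

Lemma vavg_trunc_le k t x :
  vavg (trunc k) t x <= (k%:R * fine (mu (F k)))%:E.
Proof.
rewrite EFinM -muF -[F k in leRHS]setIT -integral_indic//.
rewrite -(ge0_integralZl_fin mu (ler0n _ k) (mF1 k) (fun=> ler0n _ _)).
apply: ge0_le_integral_fin.
- apply: (measurableT_comp_transport (a := fun=> (- t)%R)) => //.
  exact: measurable_trunc.
- exact: measurable_funM.
- by move=> v; exact: trunc_ge0.
move=> v; apply: (le_trans (trunc_indic k _)) => /=.
by rewrite ler_wpM2r// ler_piMr// indicE.
Qed.

Lemma integral_trunc_lty k : \int[mu]_x \int[mu]_v (trunc k (x, v))%:E < +oo.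
Proof.
pose B := (k%:R * fine (mu (F k)))%R.
have B0 : (0 <= B)%R by rewrite mulr_ge0 ?fine_ge0.
apply: (@le_lt_trans _ _ (\int[mu]_x (B * \1_(F k) x)%:E)).
  apply: ge0_le_integral; first exact: measurableT.
  - by move=> x _; apply: integral_ge0 => v _; rewrite lee_fin trunc_ge0.
  - apply: (@measurable_fun_fubini_tonelli_F _ _ V V R mu
      (fun z => (trunc k z)%:E)).
      by apply/measurable_EFinP; exact: measurable_trunc.
    by move=> z; rewrite lee_fin trunc_ge0.
  - by apply/measurable_EFinP; exact: measurable_funM.
  move=> x _; rewrite /B mulrAC.
  have kF0 : (0 <= k%:R * \1_(F k) x :> R)%R by rewrite mulr_ge0.
  rewrite EFinM -muF -[F k in X in _ * X]setIT -integral_indic//.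
  rewrite -(ge0_integralZl_fin mu kF0 (mF1 k) (fun=> ler0n _ _)).
  apply: ge0_le_integral_fin.
  - by apply: (measurableT_comp (measurable_trunc k)); exact: measurable_fun_pair.
  - exact: measurable_funM.
  - by move=> v; exact: trunc_ge0.
  - by move=> v; exact: (trunc_indic k (x, v)).
rewrite (ge0_integralZl_fin mu B0 (mF1 k) (fun=> ler0n _ _)).
rewrite integral_indic// setIT; apply: lte_mul_pinfty; rewrite ?lee_fin//.
exact: Foo.
Qed.

(** An average bounded by B satisfies rho^r <= B^(r-1) rho, and the integral of rho is the conserved
    mass. *)
Lemma vavg_pow_trunc_lty k r t : (1 < r)%R -> vavg_pow (trunc k) r t < +oo.
Proof.
move=> r1; pose B := (k%:R * fine (mu (F k)))%R.
have B0 : (0 <= B)%R by rewrite mulr_ge0 ?fine_ge0.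
have Bp0 : 0 <= (B `^ (r - 1))%:E by rewrite lee_fin powR_ge0.
have mv : measurable_fun setT (vavg (trunc k) t).
  by apply: measurable_vavg; [exact: measurable_trunc|exact: trunc_ge0].
have v0 x : 0 <= vavg (trunc k) t x by apply: vavg_ge0; exact: trunc_ge0.
apply: (@le_lt_trans _ _ (\int[mu]_x ((B `^ (r - 1))%:E * vavg (trunc k) t x))).
  apply: ge0_le_integral; first exact: measurableT.
  - by move=> x _; exact: poweR_ge0.
  - exact: measurableT_comp_poweR.
  - exact: measurable_funeM.
  move=> x _; have := vavg_trunc_le k t x.
  move: (v0 x); case: (vavg _ _ _) => // y y0 yB.
  rewrite poweR_EFin -EFinM lee_fin; rewrite lee_fin in y0.
  rewrite lee_fin -/B in yB.
  rewrite -(mulr_powRB1 y0) ?(lt_trans _ r1)// mulrC ler_wpM2r//.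
  by rewrite ge0_ler_powR ?nnegrE// subr_ge0 ltW.
rewrite ge0_integralZl//.
apply: lte_mul_pinfty => //.
have mT : measurable_fun setT (fun z => (trunc k z)%:E).
  by apply/measurable_EFinP; exact: measurable_trunc.
have T0 z : 0 <= (trunc k z)%:E by rewrite lee_fin trunc_ge0.
by rewrite /vavg (ge0_integral_transport (- t) mT T0) integral_trunc_lty.
Qed.

Lemma vavg_pow_trunc_homo r t i j : (0 <= r)%R -> (i <= j)%N ->
  vavg_pow (trunc i) r t <= vavg_pow (trunc j) r t.
Proof.
move=> r0 ij; have mv k : measurable_fun setT (vavg (trunc k) t).
  by apply: measurable_vavg; [exact: measurable_trunc|exact: trunc_ge0].
apply: ge0_le_integral; first exact: measurableT.
- by move=> x _; exact: poweR_ge0.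
- exact: measurableT_comp_poweR.
- exact: measurableT_comp_poweR.
move=> x _; apply: ge0_le_poweR => //.
  by apply: vavg_ge0; exact: trunc_ge0.
apply: ge0_le_integral_fin.
- apply: (measurableT_comp_transport (a := fun=> (- t)%R)) => //.
  exact: measurable_trunc.
- apply: (measurableT_comp_transport (a := fun=> (- t)%R)) => //.
  exact: measurable_trunc.
- by move=> v; exact: trunc_ge0.
- by move=> v; exact: trunc_homo.
Qed.

(** Monotone convergence twice: in v, to see that the limit of the truncated averages dominates the
    full one, and then in x. *)
Lemma vavg_pow_trunc_sup r t (C : \bar R) : (0 < r)%R ->
  (forall k, vavg_pow (trunc k) r t <= C) -> vavg_pow H r t <= C.
Proof.
move=> r0 SC; pose g k x := (vavg (trunc k) t x) `^ r.
have mv k : measurable_fun setT (vavg (trunc k) t).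
  by apply: measurable_vavg; [exact: measurable_trunc|exact: trunc_ge0].
have v0 k x : 0 <= vavg (trunc k) t x by apply: vavg_ge0; exact: trunc_ge0.
have mg k : measurable_fun setT (g k) by exact: measurableT_comp_poweR.
have g0 k x : 0 <= g k x by exact: poweR_ge0.
have ndg x : nondecreasing_seq (g ^~ x).
  move=> i j ij; apply: ge0_le_poweR => //; first exact: ltW.
  apply: ge0_le_integral_fin.
  - apply: (measurableT_comp_transport (a := fun=> (- t)%R)) => //.
    exact: measurable_trunc.
  - apply: (measurableT_comp_transport (a := fun=> (- t)%R)) => //.
    exact: measurable_trunc.
  - by move=> v; exact: trunc_ge0.
  - by move=> v; exact: trunc_homo.
have cvg x := ereal_nondecreasing_is_cvgn (ndg x).
pose L x := limn (g ^~ x).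
have gL k x : g k x <= L x.
  rewrite /L (cvg_lim _ (ereal_nondecreasing_cvgn (ndg x)))//.
  by apply: ereal_sup_ubound; exists k.
apply: (@le_trans _ _ (\int[mu]_x L x)).
  apply: ge0_le_integral; first exact: measurableT.
  - by move=> x _; exact: poweR_ge0.
  - by apply: measurableT_comp_poweR; exact: measurable_vavg.
  - apply: (emeasurable_fun_cvg g) => // x _; exact: cvg.
  move=> x _.
  have L0 : 0 <= L x by exact: le_trans (gL 0%N x).
  have rn0 : r != 0%R by rewrite gt_eqF.
  rewrite -(poweRVK rn0 L0); apply: ge0_le_poweR; first exact: ltW.
    exact: vavg_ge0.
  (* The velocities at which truncation changes nothing; they exhaust R^n because the sets [Z k]
     cover phase space. *)
  pose G k := [set v | Z k (affine_Rn (- t) x v, v)].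
  have mG k : measurable (G k).
    rewrite -[G k]setTI.
    have m1 : measurable_fun setT (fun v : V => (affine_Rn (- t) x v, v)).
      by apply: measurable_fun_pair => //; exact: measurable_affine_Rn.
    exact: m1.
  apply: (ge0_integral_exhaustion_le (F := G)) => //.
  - move=> i j ij; apply/subsetPset => v; rewrite /G/=.
    by have /subsetPset := ndZ ij; exact.
  - apply/seteqP; split => // v _.
    by have [k Zk] := Zcover (affine_Rn (- t) x v, v); exists k.
  - apply/measurable_EFinP.
    by apply: (measurableT_comp_transport (a := fun=> (- t)%R)).
  - by move=> v; rewrite lee_fin.
  move=> k; apply: (@le_trans _ _ (vavg (trunc k) t x)).
    rewrite integral_mkcond le_eqVlt; apply/orP; left; apply/eqP.
    apply: eq_integral => v _; rewrite patchE /trunc.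
    have -> : ((affine_Rn (- t) x v, v) \in Z k) = (v \in G k).
      by apply/idP/idP => /set_mem vG; exact/mem_set.
    by case: ifP.
  rewrite -(poweRK rn0 (v0 k x)); apply: ge0_le_poweR.
  - by rewrite invr_ge0 ltW.
  - exact: poweR_ge0.
  - exact: (gL k).
apply: (@le_trans _ _ (limn (fun k => \int[mu]_x g k x))).
  rewrite le_eqVlt; apply/orP; left; apply/eqP.
  exact: (monotone_convergence mu measurableT mg (fun k x _ => g0 k x)
    (fun x _ => ndg x)).
apply: lime_le; last exact: nearW.
apply: ereal_nondecreasing_is_cvgn => i j ij.
by apply: vavg_pow_trunc_homo => //; exact: ltW.
Qed.

End truncation.

(** * The weak Strichartz estimate for general data *)

Section strichartz_weak.
Context {R : realType} (n : nat).
Local Notation V := (Rn R n).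
Local Notation mu := (@lebesgue_Rn R n).
Local Notation lambda := (@lebesgue_measure R).

Lemma strichartz_weak (a : R) : (1 < a)%R -> (0 < n%:R * (a - 1) < 1)%R ->
  exists2 K : R, (0 < K)%R &
  forall (H : V * V -> R) (A sigma : R), measurable_fun setT H ->
    (forall z, 0 <= H z)%R -> (0 <= A)%R -> (0 < sigma)%R ->
    \int[mu]_x \int[mu]_v (H (x, v) `^ a)%:E <= A%:E ->
    lambda [set t | sigma%:E < vavg_pow H (a / (2 - a)) t] <=
    ((K * (A * sigma `^ (a - 2))) `^ (n%:R * (a - 1))^-1)%:E.
Proof.
move=> a1 al01; have /andP[al0 al1] := al01.
have n1 : (1 <= n%:R :> R)%R.
  by rewrite ler1n lt0n; apply/eqP => n0; move: al0; rewrite n0 mul0r ltxx.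
(* From n (a - 1) < 1 and n >= 1. *)
have a2 : (a < 2)%R by nra.
have a12 : (1 < a < 2)%R by rewrite a1.
have [C C0 kernel] := power_kernel_integral_le al01.
exists C => // H A sigma mH H0 A0 sigma0 HA.
set r := (a / (2 - a))%R.
have r1 : (1 < r)%R by rewrite /r ltr_pdivlMr; lra.
have r0 : (0 < r)%R by rewrite (lt_trans _ r1).
have /sigma_finiteP[F [FT ndF Foo]] := sigma_finiteT mu.
have mF k : measurable (F k) by have [] := Foo k.
have muF k : mu (F k) < +oo by have [] := Foo k.
pose T k := trunc H F k.
have mT k : measurable_fun setT (T k) by exact: measurable_trunc.
have T0 k z : (0 <= T k z)%R by exact: trunc_ge0.
have TH k z : (T k z <= H z)%R by exact: trunc_le.
have homoS i j t : (i <= j)%N -> vavg_pow (T i) r t <= vavg_pow (T j) r t.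
  by move=> ij; exact: (vavg_pow_trunc_homo mH H0 ndF mF t (ltW r0) ij).
have supS t (D : \bar R) : (forall k, vavg_pow (T k) r t <= D) ->
    vavg_pow H r t <= D.
  exact: (vavg_pow_trunc_sup mH H0 FT ndF mF).
have vfin k t x : vavg (T k) t x < +oo.
  by rewrite (le_lt_trans (vavg_trunc_le mH H0 mF muF k t x))// ltry.
have Sfin k t : vavg_pow (T k) r t < +oo by exact: vavg_pow_trunc_lty.
clearbody T.
have mS k : measurable_fun setT (vavg_pow (T k) r) by exact: measurable_vavg_pow.
(* Sets of finite measure that increase to the level set of the full S; a bound uniform in [k]
   passes to the limit by continuity of the measure. *)
pose E k := [set t : R | (`|t| <= k%:R)%R] `&`
  [set t | sigma%:E < vavg_pow (T k) r t].
have mE k : measurable (E k).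
  apply: measurableI.
    rewrite -[X in measurable X]setTI.
    exact: (measurable_fun_ler (@normr_measurable R setT)
      (measurable_cst (k%:R : R))).
  rewrite -[X in measurable X]setTI.
  exact: emeasurable_fun_o_infty.
have ndE : nondecreasing_seq E.
  move=> i j ij; apply/subsetPset => t [/= ti st]; split => /=.
    by rewrite (le_trans ti)// ler_nat.
  exact: (lt_le_trans st (homoS _ _ _ ij)).
have EE : [set t | sigma%:E < vavg_pow H r t] = \bigcup_k E k.
  apply/seteqP; split => [t /= st|t [k _ [_ /= st]]].
    have [k sk] : exists k, sigma%:E < vavg_pow (T k) r t.
      (* If no truncated S exceeded sigma at time t, their limit would not exceed it either. *)
      apply: contrapT => /forallNP Tk; move: st; apply/negP; rewrite -leNgt.
      apply: supS => k.
      by rewrite leNgt; apply/negP; exact: Tk.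
    exists (maxn (Num.truncn `|t|).+1 k); first by [].
    split => /=.
      rewrite (@le_trans _ _ (Num.truncn `|t|).+1%:R)//.
        by rewrite ltW// -truncn_lt_nat.
      by rewrite ler_nat leq_maxl.
    exact: (lt_le_trans sk (homoS _ _ _ (leq_maxr _ _))).
  apply: (lt_le_trans st).
  apply: ge0_le_integral; first exact: measurableT.
  - by move=> x _; exact: poweR_ge0.
  - by apply: measurableT_comp_poweR; exact: measurable_vavg.
  - by apply: measurableT_comp_poweR; exact: measurable_vavg.
  move=> x _; apply: ge0_le_poweR; [exact: ltW|exact: vavg_ge0|].
  apply: ge0_le_integral_fin.
  - by apply: (measurableT_comp_transport (a := fun=> (- t)%R)).
  - by apply: (measurableT_comp_transport (a := fun=> (- t)%R)).
  - by [].
  - by move=> v; exact: TH.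
rewrite EE.
have cvgE := @nondecreasing_cvg_mu _ _ _ lambda E mE
  (bigcupT_measurable _ mE) ndE.
rewrite -(cvg_lim _ cvgE)//; apply: lime_le; first by apply/cvgP: cvgE.
apply: nearW => k /=.
have Efin : lambda (E k) \is a fin_num.
  rewrite ge0_fin_numE//; apply: (@le_lt_trans _ _
    (lambda `[(- k%:R)%R, k%:R]%classic)).
    apply: le_measure; [by rewrite inE; exact: mE|by rewrite inE|].
    move=> t [/= tk _].
    by rewrite /= in_itv/= -ler_norml.
  by rewrite /= lebesgue_measure_itv/= lte_fin; case: ifP; rewrite -?EFinB ltry.
have Em : lambda (E k) = (fine (lambda (E k)))%:E by rewrite fineK.
have [m0|m0] := ltP 0%R (fine (lambda (E k))); last first.
  by rewrite Em lee_fin (le_trans m0)// powR_ge0.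
rewrite Em lee_fin; apply: powR_weak_type_bound => //.
apply: (@strichartz_bounded R n a C A (T k) a12 C0 kernel (mT k) (T0 k) _ _ _
  (E k) _ sigma (mE k) Em m0 sigma0) => //.
- have mHa : measurable_fun setT (fun z => (H z `^ a)%:E).
    by apply/measurable_EFinP; apply: (measurableT_comp (measurable_powR _) mH).
  have Ha0 z : 0 <= (H z `^ a)%:E by rewrite lee_fin powR_ge0.
  apply: (le_trans _ HA).
  apply: (@le_trans _ _ (\int[mu \x mu]_z (H z `^ a)%:E)); last first.
    rewrite le_eqVlt; apply/orP; left; apply/eqP.
    exact: (@fubini_tonelli1 _ _ V V R mu mu _ mHa Ha0).
  apply: ge0_le_integral_fin.
  + exact: (measurableT_comp (measurable_powR _) (mT k)).
  + exact: (measurableT_comp (measurable_powR _) mH).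
  + by move=> z; exact: powR_ge0.
  + move=> z; apply: ge0_ler_powR; last exact: TH.
    * exact: le_trans ler01 (ltW a1).
    * by rewrite nnegrE T0.
    * by rewrite nnegrE H0.
by move=> t [].
Qed.

End strichartz_weak.

(** * Weak-type bounds for velocity averages *)

Section weak_type.
Context {R : realType} (n : nat).
Local Notation V := (Rn R n).
Local Notation mu := (@lebesgue_Rn R n).
Local Notation lambda := (@lebesgue_measure R).

Lemma lebesgue_measure_centered_le (tau : R) : (0 <= tau)%R ->
  lambda [set t : R | (`|t| <= tau)%R] <= (2 * tau)%:E.
Proof.
move=> tau0; rewrite (_ : [set t : R | _] = `[(- tau)%R, tau]%classic); last first.
  by apply/seteqP; split=> t /=; rewrite in_itv/= ler_norml.
rewrite lebesgue_measure_itv/= lte_fin; case: ifP => _.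
  by rewrite -EFinB lee_fin; lra.
by rewrite lee_fin mulr_ge0.
Qed.

Lemma measurable_centered (tau : R) :
  measurable [set t : measurableTypeR R | (`|t| <= tau)%R].
Proof.
rewrite -[X in measurable X]setTI.
exact: (measurable_fun_ler (@normr_measurable R setT) (measurable_cst tau)).
Qed.

(* The weak-type estimate for F = |f|^p, that is, with (b, c, r) standing for
   (b/p, c/p, r/p); e > 0 spares the case A = 0. *)
Definition vavg_weak_type (b c r : R) := exists2 K : R, (0 < K)%R &
  forall (F : V * V -> R) (A e sigma : R), measurable_fun setT F ->
    (forall z, 0 <= F z)%R -> (0 <= A)%R -> (0 < e)%R -> (0 < sigma)%R ->
    \int[mu]_x (\int[mu]_v (F (x, v) `^ c)%:E) `^ (b / c) <= A%:E ->
    lambda [set t | sigma%:E < vavg_pow F r t] <=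
    (K * ((A + e) `^ (c / b) * sigma `^ (- (c / r))) `^
      (n%:R * (c - 1))^-1)%:E.

Lemma vavg_pow_interpolation (F : V * V -> R) (b c r A e : R) :
  measurable_fun setT F -> (forall z, 0 <= F z)%R ->
  (1 <= b)%R -> (b <= c)%R -> (1 < c)%R -> (0 < r)%R -> (0 <= A)%R ->
  (0 < e)%R ->
  \int[mu]_x (\int[mu]_v (F (x, v) `^ c)%:E) `^ (b / c) <= A%:E ->
  let th := (1 + c^-1 - b^-1)%R in
  exists H : V * V -> R, [/\ measurable_fun setT H, forall z, (0 <= H z)%R,
    \int[mu]_x \int[mu]_v (H (x, v) `^ (th * c))%:E <= (A + e)%:E &
    forall t, t != 0%R -> vavg_pow F r t <=
      ((`|t| ^- n * (A + e)) `^ ((1 - th) * r))%:E * vavg_pow H (th * r) t].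
Proof.
move=> mF F0 b1 bc c1 r0 A0 e0 FA th.
have b0 : (0 < b)%R by rewrite (lt_le_trans _ b1).
have c0 : (0 < c)%R by rewrite (lt_trans _ c1).
have cb : (c^-1 <= b^-1)%R by rewrite lef_pV2.
have b1' : (b^-1 <= 1)%R by rewrite invf_le1.
have c0' : (0 < c^-1)%R by rewrite invr_gt0.
have th01 : (0 < th <= 1)%R by rewrite /th; apply/andP; split; lra.
have [H [mH H0 HA FH]] := transport_interpolation mF F0 b0 c0 th01 erefl e0 FA.
exists H; split => // t t0.
have B0 : (0 <= `|t| ^- n * (A + e))%R.
  by rewrite mulr_ge0 ?invr_ge0 ?exprn_ge0// addr_ge0// ltW.
have mvH : measurable_fun setT (vavg H t) by exact: measurable_vavg.
have vH0 x : 0 <= vavg H t x by exact: vavg_ge0.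
rewrite /vavg_pow -ge0_integralZl//; last 3 first.
- exact: measurableT_comp_poweR.
- by move=> x _; exact: poweR_ge0.
- by rewrite lee_fin powR_ge0.
apply: ge0_le_integral; first exact: measurableT.
- by move=> x _; exact: poweR_ge0.
- by apply: measurableT_comp_poweR; exact: measurable_vavg.
- by apply: measurable_funeM; exact: measurableT_comp_poweR.
move=> x _; rewrite powRrM -poweR_EFin poweRrM.
rewrite -poweRM ?poweR_ge0 ?lee_fin ?powR_ge0//.
apply: ge0_le_poweR; [exact: ltW|exact: vavg_ge0|exact: FH].
Qed.

(** Here th c = 1, so H is integrable and its mass bounds rho_H at every time. Hence S_F(t) <=
    |t|^(-n(c-1)) (A + e)^c: the level set lies in an interval around 0, and 2 is the ratio of its
    length to its radius. *)
Lemma vavg_weak_type_endpoint (c : R) : (0 < n)%N -> (1 < c)%R ->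
  vavg_weak_type 1 c c.
Proof.
move=> n0 c1; exists 2%R => // F A e sigma mF F0 A0 e0 sigma0 FA.
have c0 : (0 < c)%R by rewrite (lt_trans _ c1).
have cn0 : c != 0%R by rewrite gt_eqF.
have [H [mH H0 HA FH]] := vavg_pow_interpolation mF F0 (lexx 1%R) (ltW c1) c1 c0
  A0 e0 FA.
set B := (A + e)%R in HA FH *.
have B0 : (0 < B)%R by rewrite ltr_wpDl.
have N0 : (0 < n%:R * (c - 1))%R by rewrite mulr_gt0 ?ltr0n// subr_gt0.
set N := (n%:R * (c - 1))%R in N0 *.
set tau := ((B `^ (c / 1) * sigma `^ (- (c / c))) `^ N^-1)%R.
have tau0 : (0 < tau)%R by rewrite !(powR_gt0, mulr_gt0).
apply: le_trans (lebesgue_measure_centered_le (ltW tau0)).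
have thE : (1 + c^-1 - 1^-1 = c^-1 :> R)%R by rewrite invr1; ring.
rewrite thE mulVf// in HA FH.
apply: le_measure; rewrite ?inE.
- rewrite -[X in measurable X]setTI; apply: emeasurable_fun_o_infty => //.
  exact: measurable_vavg_pow.
- exact: measurable_centered.
move=> t /= st; rewrite leNgt; apply/negP => tau_t.
have t0 : (0 < `|t|)%R by rewrite (lt_trans tau0).
have tn0 : t != 0%R by rewrite -normr_gt0.
have pH : vavg_pow H 1 t <= B%:E.
  apply: le_trans HA; rewrite le_eqVlt; apply/orP; left; apply/eqP.
  have mHE : measurable_fun setT (EFin \o H) by exact/measurable_EFinP.
  have H0E z : 0 <= (EFin \o H) z by rewrite lee_fin.
  have := ge0_integral_transport (- t) mHE H0E.
  rewrite /vavg_pow => E.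
  transitivity (\int[mu]_x vavg H t x).
    by apply: eq_integral => x _; rewrite poweRe1// vavg_ge0.
  apply: (etrans E); apply: eq_integral => x _; apply: eq_integral => v _ /=.
  by rewrite powRr1.
have Bt0 : (0 <= `|t| ^- n * B)%R.
  by rewrite mulr_ge0 ?invr_ge0 ?exprn_ge0// ltW.
have : sigma%:E < ((`|t| ^- n * B) `^ ((1 - c^-1) * c) * B)%:E.
  rewrite (lt_le_trans st)// (le_trans (FH t tn0))// [leRHS]EFinM.
  by rewrite lee_wpmul2l// lee_fin powR_ge0.
rewrite lte_fin; apply/negP; rewrite -leNgt.
have -> : ((1 - c^-1) * c = c - 1)%R by rewrite mulrBl mul1r mulVf.
rewrite powRM ?invr_ge0 ?exprn_ge0 ?(ltW B0)// -powR_invn// -powRrM mulNr -/N.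
have BE : (B `^ (c - 1) * B = B `^ c)%R by rewrite mulrC mulr_powRB1// ltW.
rewrite -mulrA BE powRN mulrC ler_pdivrMr ?powR_gt0//.
have tN : (tau `^ N = B `^ c / sigma)%R.
  rewrite /tau -powRrM mulVf ?gt_eqF// powRr1 ?mulr_ge0 ?powR_ge0//.
  by rewrite divr1 divff// powR_inv1// ltW.
rewrite -ler_pdivrMl// mulrC -tN.
by apply: ge0_ler_powR; rewrite ?nnegrE// ltW.
Qed.

(** Times are cut at [tau]. The near times give the 2 in the constant; at the far times the
    dispersive factor is at most its value [D] at [tau], so S_H exceeds sigma / D and the weak
    Strichartz estimate applies. *)
Lemma vavg_weak_type_interior (b c r : R) : (0 < n)%N -> (1 < b)%R ->
  (b <= c)%R -> (0 < r)%R -> (r^-1 = b^-1 + c^-1 - 1)%R ->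
  (n%:R * (c * (1 - b^-1)) < 1)%R ->
  vavg_weak_type b c r.
Proof.
move=> n0 b1 bc r0 rE nc.
have c1 : (1 < c)%R by rewrite (lt_le_trans b1).
have c0 : (0 < c)%R by rewrite (lt_trans _ c1).
have b0 : (0 < b)%R by rewrite (lt_trans _ b1).
have b1' : (b^-1 < 1)%R by rewrite invf_lt1.
have n0' : (0 < n%:R :> R)%R by rewrite ltr0n.
have cV : (c * c^-1 = 1)%R by rewrite divff// gt_eqF.
set th := (1 + c^-1 - b^-1)%R.
set a := (th * c)%R.
have aE : (a - 1 = c * (1 - b^-1))%R by rewrite /a /th; lra.
have a1 : (1 < a)%R by rewrite -subr_gt0 aE mulr_gt0// subr_gt0.
have al01 : (0 < n%:R * (a - 1) < 1)%R.
  by rewrite aE nc andbT mulr_gt0// mulr_gt0// subr_gt0.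
(* The relation between b, c and r enters here: it makes th r equal to the exponent a / (2 - a) of
   the Strichartz estimate. *)
have a2 : (2 - a = c / r)%R by rewrite rE /a /th; lra.
have a20 : (0 < 2 - a)%R by rewrite a2 divr_gt0.
have thr : (a / (2 - a) = th * r)%R.
  by rewrite a2 /a; field; rewrite !gt_eqF.
have [K K0 weak] := strichartz_weak a1 al01.
set al := (n%:R * (a - 1))%R in al01 weak.
have /andP[al0 al1] := al01.
exists (2 + K `^ al^-1)%R.
  by rewrite addr_gt0// powR_gt0.
move=> F A e sigma mF F0 A0 e0 sigma0 FA.
have [H [mH H0 HA FH]] := vavg_pow_interpolation mF F0 (ltW b1) bc c1 r0
  A0 e0 FA.
rewrite -/th in HA FH.
set B := (A + e)%R in HA FH *.
have B0 : (0 < B)%R by rewrite ltr_wpDl.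
set N := (n%:R * (c - 1))%R.
have N0 : (0 < N)%R by rewrite mulr_gt0// subr_gt0.
(* The balancing time: by [Bsig] below, the Strichartz bound at level sigma / D is then a constant
   times [tau] too. *)
set tau := ((B `^ (c / b) * sigma `^ (- (c / r))) `^ N^-1)%R.
have tau0 : (0 < tau)%R by rewrite !(powR_gt0, mulr_gt0).
have tauN : (tau `^ N = B `^ (c / b) * sigma `^ (- (c / r)))%R.
  by rewrite /tau -powRrM mulVf ?gt_eqF// powRr1 ?mulr_ge0 ?powR_ge0.
have Bt0 : (0 < tau ^- n * B)%R by rewrite mulr_gt0// invr_gt0 exprn_gt0.
pose D := ((tau ^- n * B) `^ ((1 - th) * r))%R.
have D0 : (0 < D)%R by rewrite powR_gt0.
have sD0 : (0 < sigma / D)%R by rewrite divr_gt0.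
have th1 : (th <= 1)%R.
  have : (c^-1 <= b^-1)%R by rewrite lef_pV2.
  by rewrite /th; lra.
have sub : [set t | sigma%:E < vavg_pow F r t] `<=`
    [set t : R | (`|t| <= tau)%R] `|`
    [set t | (sigma / D)%:E < vavg_pow H (a / (2 - a)) t].
  move=> t /= st; have [|tau_t] := leP `|t|%R tau; [by left|right].
  have t0 : (0 < `|t|)%R by rewrite (lt_trans tau0).
  have tn0 : t != 0%R by rewrite -normr_gt0.
  rewrite mulrC EFinM lte_pdivrMl// thr (lt_le_trans st)//.
  rewrite (le_trans (FH t tn0))// lee_wpmul2r ?vavg_pow_ge0// lee_fin.
  apply: ge0_ler_powR.
  - by rewrite mulr_ge0 ?subr_ge0// ltW.
  - by rewrite nnegrE mulr_ge0 ?invr_ge0 ?exprn_ge0// ltW.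
  - by rewrite nnegrE ltW.
  rewrite ler_pM2r// lef_pV2 ?posrE ?exprn_gt0//.
  by apply: lerXn2r; rewrite ?nnegrE ltW.
have mS (h : V * V -> R) s s' : measurable_fun setT h -> (forall z, 0 <= h z)%R ->
    measurable [set t : measurableTypeR R | s%:E < vavg_pow h s' t].
  move=> mh h0; rewrite -[X in measurable X]setTI.
  by apply: emeasurable_fun_o_infty => //; exact: measurable_vavg_pow.
apply: (@le_trans _ _ (lambda ([set t : R | (`|t| <= tau)%R] `|`
    [set t | (sigma / D)%:E < vavg_pow H (a / (2 - a)) t]))).
  apply: le_measure; rewrite ?inE//; first exact: mS.
  by apply: measurableU; [exact: measurable_centered|exact: mS].
apply: (le_trans (measureU2 _ _ _)).
- exact: measurable_centered.
- exact: mS.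
rewrite mulrDl EFinD; apply: leeD.
  exact: (lebesgue_measure_centered_le (ltW tau0)).
apply: (le_trans (weak H B (sigma / D)%R mH H0 (ltW B0) sD0 HA)).
rewrite lee_fin (powRM _ (ltW K0) (mulr_ge0 (ltW B0) (powR_ge0 _ _))).
apply: ler_wpM2l; first exact: powR_ge0.
have DV0 : (0 <= D^-1)%R by rewrite invr_ge0 ltW.
have tn0 : (0 <= tau ^- n)%R by rewrite invr_ge0 exprn_ge0// ltW.
have Bsig : (B * (sigma / D) `^ (a - 2) = tau `^ al)%R.
  have -> : (a - 2 = - (c / r))%R by rewrite -a2 opprB.
  rewrite (powRM _ (ltW sigma0) DV0).
  have -> : (D^-1 `^ (- (c / r)) = (tau ^- n * B) `^ ((1 - th) * c))%R.
    rewrite -(powR_inv1 (ltW D0)) /D -!powRrM; congr (_ `^ _)%R.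
    by field; rewrite gt_eqF.
  rewrite (powRM _ tn0 (ltW B0)).
  have BB : (B `^ (c / b) = B * B `^ ((1 - th) * c))%R.
    rewrite -{2}(powRr1 (ltW B0)) -powRD; last first.
      by rewrite (gt_eqF B0) implybT.
    by congr (_ `^ _)%R; rewrite /th; lra.
  have tt : (tau `^ al = tau `^ N * (tau ^- n) `^ ((1 - th) * c))%R.
    rewrite -(powR_invn n (ltW tau0)) -powRrM -powRD; last first.
      by rewrite (gt_eqF tau0) implybT.
    by congr (_ `^ _)%R; rewrite /N /al /a /th; lra.
  rewrite tt tauN BB.
  move: (sigma `^ _)%R ((tau ^- n) `^ _)%R (B `^ _)%R => y1 y2 y3.
  by ring.
rewrite Bsig -powRrM divff ?(gt_eqF al0)// powRr1 ?lexx//.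
exact: ltW.
Qed.

End weak_type.

(** * Mixed norms, essential suprema and null sets *)

Section mixed_norms.
Context {R : realType} (n : nat).
Local Notation V := (Rn R n).
Local Notation mu := (@lebesgue_Rn R n).
Local Notation lambda := (@lebesgue_measure R).

Lemma mixed_norm_ge0 (b c : \bar R) (f : V * V -> R) : 0 <= mixed_norm b c f.
Proof. exact: Lnorm_ge0. Qed.

Lemma Lnorm_finE d (T : measurableType d) (m : {measure set T -> \bar R})
    (p : R) (g : T -> \bar R) :
  Lnorm m p%:E g = (\int[m]_x `|g x| `^ p) `^ p^-1.
Proof. by rewrite unlock. Qed.

Lemma mixed_norm_finE (b c : R) (f : V * V -> R) :
  mixed_norm b%:E c%:E f =
  (\int[mu]_x (\int[mu]_v (`|f (x, v)| `^ c)%:E) `^ (b / c)) `^ b^-1.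
Proof.
rewrite /mixed_norm unlock; congr (_ `^ _); apply: eq_integral => x _.
rewrite gee0_abs ?poweR_ge0// -poweRrM mulrC; congr (_ `^ _).
Qed.

Lemma mixed_norm_transportE (p r t : R) (f : V * V -> R) :
  mixed_norm r%:E p%:E (transport t f) =
  (vavg_pow (fun z => `|f z| `^ p)%R (r / p) t) `^ r^-1.
Proof.
rewrite mixed_norm_finE; apply: (congr1 (fun y => y `^ r^-1)).
apply: eq_integral => x _; apply: (congr1 (fun y => y `^ (r / p))).
by apply: eq_integral => v _; rewrite transportE.
Qed.

Lemma lebesgue_Rn_setT_gt0 : 0 < mu [set: V].
Proof.
have -> : [set: V] = [set x : V | forall i : 'I_n, [set: R] (tnth x i)].
  by apply/seteqP; split.
rewrite (lebesgue_Rn_box (A := fun=> setT))//.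
have lT : 0 < lambda [set: R].
  apply: (@lt_le_trans _ _ (lambda `[0%R, 1%R]%classic)).
    by rewrite lebesgue_measure_itv/= lte_fin ltr01 -EFinB subr0 lte_fin.
  by apply: le_measure; rewrite ?inE.
by elim/big_ind : _ => // x y x0 y0; exact: mule_gt0.
Qed.

Lemma Lnorm_yE d (T : measurableType d) (m : {measure set T -> \bar R})
    (g : T -> \bar R) : 0 < m [set: T] -> Lnorm m +oo g = ess_sup m (abse \o g).
Proof. by rewrite unlock => ->. Qed.

Lemma Lnorm_y_le d (T : measurableType d) (m : {measure set T -> \bar R})
    (g : T -> \bar R) (C : \bar R) : 0 <= C ->
  {ae m, forall x, `|g x| <= C} -> Lnorm m +oo g <= C.
Proof.
by move=> C0 gC; rewrite unlock; case: ifPn => // _; exact/ess_supP.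
Qed.

Lemma ae_Lnorm_y_ge (g : V -> \bar R) :
  {ae mu, forall x, `|g x| <= Lnorm mu +oo g}.
Proof. by rewrite (Lnorm_yE _ lebesgue_Rn_setT_gt0); exact: ess_sup_ge. Qed.

(** The flow preserves null sets: conservation of mass for the indicator of Z. *)
Lemma ae_transport (Z : set (V * V)) (t : R) : measurable Z ->
  {ae mu, forall x, {ae mu, forall v, ~ Z (x, v)}} ->
  {ae mu, forall x, {ae mu, forall v, ~ Z (affine_Rn t x v, v)}}.
Proof.
move=> mZ Z0.
have mI : measurable_fun setT (fun z : V * V => (\1_Z z : R)%:E).
  by apply/measurable_EFinP; exact: measurable_indic.
have I0 (z : V * V) : 0 <= (\1_Z z : R)%:E by rewrite lee_fin.
have mIx (x : V) : measurable_fun setT (fun v : V => (\1_Z (x, v) : R)%:E).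
  by apply: (measurableT_comp mI); exact: measurable_fun_pair.
have IZ : \int[mu]_x \int[mu]_v (\1_Z (affine_Rn t x v, v) : R)%:E = 0.
  apply: (etrans (ge0_integral_transport t mI I0)).
  have mF := @measurable_fun_fubini_tonelli_F _ _ V V R mu _ mI I0.
  rewrite (@ge0_ae_eq_integral _ _ _ mu setT _ (cst 0))//.
  - exact: integral0.
  - by move=> x _; exact: integral_ge0.
  apply: filterS Z0 => x Zx _ /=.
  rewrite (@ge0_ae_eq_integral _ _ _ mu setT _ (cst 0))//.
  - exact: integral0.
  apply: filterS Zx => v Zv _ /=; rewrite indicE memNset//.
have mIt : measurable_fun setT
    (fun z : V * V => (\1_Z (affine_Rn t z.1 z.2, z.2) : R)%:E).
  exact: (measurable_comp_transport t mI).
have mF := @measurable_fun_fubini_tonelli_F _ _ V V R mu _ mIt (fun=> I0 _).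
have F0 x : 0 <= \int[mu]_v (\1_Z (affine_Rn t x v, v) : R)%:E.
  exact: integral_ge0.
have := ge0_integral_eq0_ae mF F0 IZ; apply: filterS => x /(_ I) /= Ix.
have mx : measurable_fun setT (fun v : V => (\1_Z (affine_Rn t x v, v) : R)%:E).
  exact: (measurableT_comp_transport (a := fun=> t) (x := fun=> x) mI).
have := ge0_integral_eq0_ae mx (fun=> I0 _) Ix; apply: filterS => v /(_ I) /=.
rewrite indicE => + Zv; rewrite mem_set// => /eqP.
by rewrite eqe oner_eq0.
Qed.

(** The essential supremum of a slice exceeds y exactly when the slice of {|f| > y} has positive
    measure, and the measure of a slice is measurable in x. *)
Lemma measurable_Lnorm_y_slice (f : V * V -> R) : measurable_fun setT f ->
  measurable_fun setT (fun x => Lnorm mu +oo (fun v => (f (x, v))%:E)).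
Proof.
move=> mf mT; apply: (measurability _ (ErealGenOInfty.measurableE R) _ mT).
move=> _ [_ [y ->] <-]; rewrite setTI.
pose Z := [set z : V * V | y%:E < `|f z|%:E].
have mnf : measurable_fun setT (fun z => `|f z|%R) by exact: measurableT_comp.
have mZ : measurable Z.
  rewrite -[X in measurable X]setTI; apply: emeasurable_fun_o_infty => //.
  exact/measurable_EFinP.
have mX := measurable_fun_xsection mu mZ.
have xsE x : xsection Z x =
    (abse \o (fun v => (f (x, v))%:E)) @^-1` `]y%:E, +oo[%classic.
  by apply/seteqP; split => v; rewrite /xsection /= inE /Z/= in_itv/= andbT.
have mfx x : measurable_fun setT (abse \o (fun v => (f (x, v))%:E)).
  apply/measurable_EFinP; apply: (measurableT_comp mnf).
  exact: measurable_fun_pair.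
have NE x : Lnorm mu +oo (fun v => (f (x, v))%:E) <= y%:E <->
    mu (xsection Z x) = 0.
  rewrite (Lnorm_yE _ lebesgue_Rn_setT_gt0) xsE; split.
    by move=> /ess_supP /(ae_le_measureP mu y%:E (mfx x)).
  by move=> /(ae_le_measureP mu y%:E (mfx x)) /ess_supP.
rewrite (_ : _ @^-1` _ = [set x | 0 < (mu \o xsection Z) x]).
  by rewrite -[X in measurable X]setTI; exact: emeasurable_fun_o_infty.
apply/seteqP; split => x /=; rewrite in_itv/= andbT => h.
- rewrite lt0e measure_ge0 andbT; apply/eqP => /NE.
  by rewrite leNgt h.
- rewrite ltNge; apply/negP => /NE xs0; move: h.
  by rewrite xs0 ltxx.
Qed.

(** [lebesgue_measure] is an outer measure on arbitrary sets. This serves for r = +oo, where the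
    measurability in t of the norm is not established. *)
Lemma lebesgue_measure_mono (A B : set R) : A `<=` B ->
  lambda A <= lambda B.
Proof.
move=> AB; rewrite /lebesgue_measure/= /lebesgue_stieltjes_measure.
rewrite /measure_extension.
exact: le_mu_ext.
Qed.

End mixed_norms.

(** * From velocity averages back to the transport operator *)

Section transport_estimates.
Context {R : realType} (n : nat).
Local Notation V := (Rn R n).
Local Notation mu := (@lebesgue_Rn R n).
Local Notation lambda := (@lebesgue_measure R).
Implicit Types f : V * V -> R.

(** The norm of U(t)f exceeds s exactly when S_F(t) exceeds s^r, for F = |f|^p. The value of [q]
    turns the exponent 1/(n(c/p - 1)) of the weak-type bound into 1/c, so the powers of s cancel. *)
Lemma weak_norm_transport_le (p r b c q : R) :
  (0 < p)%R -> (0 < r)%R -> (0 < b)%R -> (p < c)%R -> (0 < q)%R -> (0 < n)%N ->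
  (q^-1 = n%:R / p - n%:R / c)%R ->
  vavg_weak_type (R := R) n (b / p) (c / p) (r / p) ->
  exists2 C : R, (0 < C)%R & forall f, mixed_Lebesgue b%:E c%:E f ->
    weak_norm lambda q%:E (fun t => mixed_norm r%:E p%:E (transport t f)) <=
    C%:E * mixed_norm b%:E c%:E f.
Proof.
move=> p0 r0 b0 pc q0 n0 qE [K K0 weak].
have c0 : (0 < c)%R by rewrite (lt_trans p0).
have bn0 : b != 0%R by rewrite gt_eqF.
have pn0 : p != 0%R by rewrite gt_eqF.
have cn0 : c != 0%R by rewrite gt_eqF.
have rn0 : r != 0%R by rewrite gt_eqF.
have qn0 : q^-1%R != 0%R by rewrite gt_eqF// invr_gt0.
have n0' : (n%:R != 0 :> R)%R by rewrite pnatr_eq0 -lt0n.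
exists (K `^ q^-1)%R; first exact: powR_gt0.
move=> f [mf fin].
pose F z := (`|f z| `^ p)%R.
have mF : measurable_fun setT F.
  apply: (measurableT_comp (measurable_powR _)); exact: measurableT_comp.
have F0 z : (0 <= F z)%R by exact: powR_ge0.
have [M M0 ME] : exists2 M : R, (0 <= M)%R & mixed_norm b%:E c%:E f = M%:E.
  exists (fine (mixed_norm b%:E c%:E f)); first by rewrite fine_ge0// mixed_norm_ge0.
  by rewrite fineK// ge0_fin_numE// mixed_norm_ge0.
pose A := (M `^ b)%R.
have A0 : (0 <= A)%R by exact: powR_ge0.
have FA : \int[mu]_x (\int[mu]_v (F (x, v) `^ (c / p))%:E) `^ (b / p / (c / p)) <=
    A%:E.
  rewrite /A -poweR_EFin -ME mixed_norm_finE poweRVK//; last first.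
    by apply: integral_ge0 => x _; exact: poweR_ge0.
  rewrite le_eqVlt; apply/orP; left; apply/eqP; apply: eq_integral => x _.
  rewrite (_ : (b / p / (c / p) = b / c)%R); last first.
    by field; rewrite ?pn0 ?cn0 ?bn0 ?rn0.
  apply: (congr1 (fun y => y `^ (b / c))); apply: eq_integral => v _.
  by rewrite /F -powRrM mulrC divfK.
rewrite ME /weak_norm; apply: ge_ereal_sup => _ [s /= s0 <-].
have sr0 : (0 < s `^ r)%R by rewrite powR_gt0.
have setE : [set t | s%:E < `|mixed_norm r%:E p%:E (transport t f)|] =
    [set t | (s `^ r)%:E < vavg_pow F (r / p) t].
  apply/seteqP; split => t /=; rewrite gee0_abs ?mixed_norm_ge0//
    mixed_norm_transportE -/F => st.
  - rewrite -(poweRVK rn0 (vavg_pow_ge0 F (r / p) t)) -poweR_EFin.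
    by apply: gt0_lt_poweR => //; rewrite lee_fin ltW.
  - have sE : s%:E = (s `^ r)%:E `^ r^-1.
      by rewrite poweR_EFin -powRrM divff// powRr1// ltW.
    rewrite sE; apply: gt0_lt_poweR => //; first by rewrite invr_gt0.
    by rewrite lee_fin powR_ge0.
rewrite setE; set L := lambda _.
have key e : (0 < e)%R -> s%:E * L `^ q^-1 <=
    (K `^ q^-1 * (A + e) `^ b^-1)%:E.
  move=> e0; have Ae0 : (0 < A + e)%R by rewrite ltr_wpDl.
  have Lle := weak F A e (s `^ r)%R mF F0 A0 e0 sr0 FA.
  have qi0 : (0 <= q^-1)%R by rewrite invr_ge0 ltW.
  have := ge0_le_poweR qi0 (measure_ge0 lambda _) Lle.
  move=> /(lee_wpmul2l (_ : 0 <= s%:E)); rewrite lee_fin => /(_ (ltW s0)) Lle'.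
  apply: (le_trans Lle'); rewrite poweR_EFin -EFinM lee_fin.
  have s'0 : (0 <= s `^ (- c))%R by exact: powR_ge0.
  have -> : ((s `^ r) `^ (- (c / p / (r / p))) = s `^ (- c))%R.
    by rewrite -powRrM; congr (_ `^ _)%R; field; rewrite ?pn0 ?cn0 ?bn0 ?rn0.
  have -> : (c / p / (b / p) = c / b)%R by field; rewrite ?pn0 ?cn0 ?bn0 ?rn0.
  rewrite (powRM _ (ltW K0) (powR_ge0 _ _)) -(powRrM _ _ q^-1).
  have -> : ((n%:R * (c / p - 1))^-1 / q = c^-1)%R.
    rewrite qE; field; rewrite ?cn0 ?n0' ?pn0 ?andbT/=.
    by rewrite mulN1r subr_eq0 gt_eqF.
  rewrite (powRM _ (powR_ge0 _ _) s'0) -!powRrM.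
  have -> : (c / b / c = b^-1)%R by field; rewrite ?cn0 ?bn0.
  have -> : (- c / c = -1)%R by field.
  rewrite (powR_inv1 (ltW s0)) mulrCA [X in (_ * X <= _)%R]mulrCA.
  by rewrite divff ?gt_eqF// mulr1.
have MA : (A `^ b^-1 = M)%R by rewrite /A -powRrM divff// powRr1.
rewrite -MA -EFinM; apply/lee_addgt0Pr => d d0.
have K'0 : (0 < K `^ q^-1)%R by exact: powR_gt0.
(* Removes e: with e = y^b - A the bound is K^(1/q) y, which exceeds the desired one by exactly
   d. *)
pose y := (A `^ b^-1 + d / K `^ q^-1)%R.
have y0 : (A `^ b^-1 < y)%R by rewrite /y ltrDl divr_gt0.
have yb : (A < y `^ b)%R.
  have -> : A = ((A `^ b^-1) `^ b)%R by rewrite -powRrM mulVf// powRr1.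
  apply: gt0_ltr_powR; rewrite ?nnegrE ?powR_ge0//.
  by rewrite ltW// (le_lt_trans (powR_ge0 _ _) y0).
have e0 : (0 < y `^ b - A)%R by rewrite subr_gt0.
apply: (le_trans (key _ e0)).
have yn : (0 <= y)%R by rewrite ltW// (le_lt_trans (powR_ge0 _ _) y0).
rewrite addrC subrK -powRrM divff// powRr1// /y -EFinD lee_fin mulrDr.
by rewrite mulrCA divff ?gt_eqF// mulr1.
Qed.

(** For finite b, conservation of mass for |f|^b; for b = +oo, the set where |f| exceeds its
    essential bound is null and stays so under the flow. *)
Lemma mixed_norm_transport_diag (b : \bar R) (t : R) f : 0 < b ->
  measurable_fun setT f ->
  mixed_norm b b (transport t f) <= mixed_norm b b f.
Proof.
case: b => [b| |]// b0 mf.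
- rewrite lte_fin in b0; have bn0 : b != 0%R by rewrite gt_eqF.
  have mF : measurable_fun setT (fun z => (`|f z| `^ b)%:E).
    apply/measurable_EFinP; apply: (measurableT_comp (measurable_powR _)).
    exact: measurableT_comp.
  have F0 z : 0 <= (`|f z| `^ b)%:E by rewrite lee_fin powR_ge0.
  rewrite (mixed_norm_finE b b (transport t f)) (mixed_norm_finE b b f).
  rewrite (divff bn0).
  have E (g : V * V -> R) : \int[mu]_x (\int[mu]_v (`|g (x, v)| `^ b)%:E) `^ 1 =
      \int[mu]_x \int[mu]_v (`|g (x, v)| `^ b)%:E.
    apply: eq_integral => x _; rewrite poweRe1//.
    by apply: integral_ge0 => v _; rewrite lee_fin powR_ge0.
  rewrite le_eqVlt; apply/orP; left; apply/eqP.
  apply: (congr1 (fun y => y `^ b^-1)).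
  apply: (etrans (E (transport t f))); apply: (etrans _ (esym (E f))).
  apply: (etrans _ (ge0_integral_transport (- t) mF F0)).
  apply: eq_integral => x _; apply: eq_integral => v _.
  by rewrite transportE.
- set C := mixed_norm +oo +oo f.
  have C0 : 0 <= C by exact: mixed_norm_ge0.
  pose Z := [set z : V * V | C < `|f z|%:E].
  have mZ : measurable Z.
    rewrite -[X in measurable X]setTI; apply: emeasurable_fun_o_infty => //.
    by apply/measurable_EFinP; exact: measurableT_comp.
  have aeZ : {ae mu, forall x, {ae mu, forall v, ~ Z (x, v)}}.
    have := ae_Lnorm_y_ge (fun x : V => Lnorm mu +oo (fun v => (f (x, v))%:E)).
    apply: filterS => x; rewrite gee0_abs ?Lnorm_ge0// => Nx.
    have := ae_Lnorm_y_ge (fun v : V => (f (x, v))%:E).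
    apply: filterS => v fv; rewrite /Z/= ltNge; apply/negP/negPn.
    exact: (le_trans fv Nx).
  apply: Lnorm_y_le => //.
  apply: filterS (ae_transport (- t) mZ aeZ) => x Zx.
  rewrite gee0_abs ?Lnorm_ge0//; apply: Lnorm_y_le => //.
  apply: filterS Zx => v; rewrite transportE /Z/= => /negP.
  by rewrite -leNgt.
Qed.

(** With N(x) the essential supremum of the slice at x, |f(x - t v, v)| <= N(x - t v) outside a null
    set, and N^p is then subject to the dispersion identity. Treating the exceptional set [Z]
    requires N to be measurable. *)
Lemma mixed_norm_dispersive_y (p t : R) f : (0 < p)%R -> t != 0%R ->
  measurable_fun setT f ->
  mixed_norm +oo p%:E (transport t f) <=
  ((`|t| ^- n) `^ p^-1)%:E * mixed_norm p%:E +oo f.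
Proof.
move=> p0 t0 mf.
pose N x := Lnorm mu +oo (fun v : V => (f (x, v))%:E).
have N0 x : 0 <= N x by exact: Lnorm_ge0.
have mN : measurable_fun setT N by exact: measurable_Lnorm_y_slice.
pose Z := [set z : V * V | N z.1 < `|f z|%:E].
have mZ : measurable Z.
  rewrite -[X in measurable X]setTI; apply: emeasurable_fun_lt => //.
    exact: (measurableT_comp mN measurable_fst).
  by apply/measurable_EFinP; exact: measurableT_comp.
have aeZ : {ae mu, forall x, {ae mu, forall v, ~ Z (x, v)}}.
  apply: nearW => x; have := ae_Lnorm_y_ge (fun v : V => (f (x, v))%:E).
  by apply: filterS => v fv; rewrite /Z/= ltNge; apply/negP/negPn.
have mNp : measurable_fun setT (fun x => N x `^ p).
  exact: measurableT_comp_poweR.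
have Np0 x : 0 <= N x `^ p by exact: poweR_ge0.
have tp0 : 0 <= (`|t| ^- n)%:E by rewrite lee_fin invr_ge0 exprn_ge0.
have RE : ((`|t| ^- n) `^ p^-1)%:E * mixed_norm p%:E +oo f =
    ((`|t| ^- n)%:E * \int[mu]_x N x `^ p) `^ p^-1.
  rewrite poweRM ?integral_ge0// /mixed_norm Lnorm_finE.
  congr (_ * _ `^ _); apply: eq_integral => x _.
  by rewrite gee0_abs// -/(N x).
rewrite RE; apply: Lnorm_y_le; first exact: poweR_ge0.
apply: filterS (ae_transport (- t) mZ aeZ) => x Zx.
rewrite gee0_abs ?Lnorm_ge0// Lnorm_finE.
have pV0 : (0 <= p^-1)%R by rewrite invr_ge0 ltW.
have tn0 : (- t != 0)%R by rewrite oppr_eq0.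
apply: ge0_le_poweR => //.
  by apply: integral_ge0 => v _; exact: poweR_ge0.
have := ge0_integral_affine_Rn x tn0 mNp Np0; rewrite normrN => <-.
have maff : measurable_fun setT (fun v : V => affine_Rn (- t) x v).
  exact: measurable_affine_Rn.
apply: ae_ge0_le_integral; first exact: measurableT.
- by move=> v _; exact: poweR_ge0.
- apply: measurableT_comp_poweR; apply/measurable_EFinP.
  apply: measurableT_comp => //.
  under eq_fun do rewrite transportE.
  exact: (measurableT_comp_transport (a := fun=> (- t)%R) (x := fun=> x) mf).
- by move=> v _.
- exact: (measurableT_comp mNp maff).
apply: filterS Zx => v; rewrite /Z/= => /negP; rewrite -leNgt => fN _.
rewrite transportE -poweR_EFin; apply: ge0_le_poweR fN; first exact: ltW.
by rewrite lee_fin.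
Qed.

(** The dispersive bound is M |t|^(-1/q), so the level set at s lies in |t| <= (M / s)^q; its length
    2 (M / s)^q gives the constant. *)
Lemma weak_norm_dispersive_y (p q : R) : (0 < p)%R -> (0 < n)%N ->
  (q^-1 = n%:R / p)%R ->
  exists2 C : R, (0 < C)%R & forall f, mixed_Lebesgue p%:E +oo f ->
    weak_norm lambda q%:E (fun t => mixed_norm +oo p%:E (transport t f)) <=
    C%:E * mixed_norm p%:E +oo f.
Proof.
move=> p0 n0 qE; have n0' : (0 < n%:R :> R)%R by rewrite ltr0n.
have qi0 : (0 < q^-1)%R by rewrite qE divr_gt0.
have q0 : (0 < q)%R by rewrite -invr_gt0.
have qn0 : q != 0%R by rewrite gt_eqF.
exists (2 `^ q^-1)%R; first exact: powR_gt0.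
move=> f [mf fin].
have [M M0 ME] : exists2 M : R, (0 <= M)%R & mixed_norm p%:E +oo f = M%:E.
  exists (fine (mixed_norm p%:E +oo f)); first by rewrite fine_ge0// mixed_norm_ge0.
  by rewrite fineK// ge0_fin_numE// mixed_norm_ge0.
rewrite ME /weak_norm; apply: ge_ereal_sup => _ [s /= s0 <-].
pose tau := ((M / s) `^ q)%R.
have Ms0 : (0 <= M / s)%R by rewrite divr_ge0// ltW.
have tau0 : (0 <= tau)%R by exact: powR_ge0.
have sub : [set t | s%:E < `|mixed_norm +oo p%:E (transport t f)|] `<=`
    [set t : R | (`|t| <= tau)%R].
  move=> t /=; rewrite gee0_abs ?mixed_norm_ge0// => st.
  rewrite leNgt; apply/negP => tau_t.
  have t0 : (0 < `|t|)%R by rewrite (le_lt_trans tau0).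
  have tn0 : t != 0%R by rewrite -normr_gt0.
  have := lt_le_trans st (mixed_norm_dispersive_y p0 tn0 mf).
  rewrite ME -EFinM lte_fin; apply/negP; rewrite -leNgt.
  rewrite -(powR_invn n (ltW t0)) -powRrM mulNr -qE powRN mulrC.
  rewrite ler_pdivrMr ?powR_gt0// -ler_pdivrMl// mulrC.
  have -> : (M / s = tau `^ q^-1)%R by rewrite /tau -powRrM divff// powRr1.
  by apply: ge0_ler_powR; rewrite ?nnegrE ?(ltW qi0) ?(ltW t0) ?(ltW tau_t).
have := le_trans (lebesgue_measure_mono sub) (lebesgue_measure_centered_le tau0).
move=> /(ge0_le_poweR (ltW qi0) (measure_ge0 _ _)).
move=> /(lee_wpmul2l (_ : 0 <= s%:E)); rewrite lee_fin => /(_ (ltW s0)).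
move=> h; apply: (le_trans h); rewrite poweR_EFin -!EFinM lee_fin.
rewrite (powRM _ _ tau0)// /tau -powRrM divff// powRr1// mulrCA.
by rewrite [(s * (M / s))%R]mulrC divfK ?gt_eqF.
Qed.

End transport_estimates.

(** * Exponent arithmetic and the three cases *)

Lemma inverE (R : realType) (x : R) : x != 0%R -> x%:E^-1 = x^-1%:E.
Proof. by move=> x0; rewrite inver (negbTE x0). Qed.

(** Both branches of [rstar] imply (n - 1) r < n c. In the first it is the definition, or trivial
    when n = 1 and the bound is infinite; in the second r (2 - c) < c suffices, because c < (n +
    1)/n means n (2 - c) > n - 1. *)
Lemma lt_rstar (R : realType) (n : nat) (c r : R) : (0 < n)%N -> (0 < c)%R ->
  r%:E < rstar n c%:E -> (n%:R * r < n%:R * c + r)%R.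
Proof.
move=> n0 c0; have n0' : (0 < n%:R :> R)%R by rewrite ltr0n.
have nE : (n%:R = n.-1%:R + 1 :> R)%R by rewrite natr1 prednK.
have n1 : (0 <= n.-1%:R :> R)%R by [].
rewrite /rstar; case: ifPn => [_|].
  have [n10|n10] := eqVneq (n.-1%:R : R)%R 0%R.
    by move=> _; rewrite nE n10 add0r !mul1r; lra.
  have {}n1 : (0 < n.-1%:R :> R)%R by rewrite lt0r n10.
  rewrite inverE// -!EFinM lte_fin ltr_pdivlMr// => h.
  by rewrite [X in (X * r)%R]nE; lra.
rewrite -ltNge lte_fin ltr_pdivlMr// -natr1 => cn.
have n1' : (1 <= n%:R :> R)%R by rewrite ler1n.
have c2 : (0 < 2 - c)%R by nra.
rewrite -EFinB inverE ?gt_eqF// -EFinM lte_fin ltr_pdivlMr// => h.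
rewrite -subr_gt0 -(pmulr_lgt0 _ c2).
have h1 : (n.-1%:R * (r * (2 - c)) <= n.-1%:R * c)%R by rewrite ler_wpM2l// ltW.
nra.
Qed.

Lemma HM_inj (R : realType) (p r b c : R) :
  (0 < p)%R -> (0 < r)%R -> (0 < b)%R -> (0 < c)%R ->
  HM p%:E r%:E = HM b%:E c%:E -> (p^-1 + r^-1 = b^-1 + c^-1)%R.
Proof.
move=> p0 r0 b0 c0; rewrite /HM => /(can_inj (@inveK R)).
rewrite !inverE ?gt_eqF// => -[] h.
by apply: (@mulfI _ 2^-1%R); rewrite ?invr_eq0.
Qed.

Theorem corollary2p9 (R : realType) (n : nat) (hn : (1 <= n)%N)
    (q r p b c : \bar R) :
  [\/ [/\ 1 < q < +oo, 1 <= p < +oo, 1 <= r < +oo &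
        [/\ q^-1 + n%:R%:E / r = n%:R%:E / b,
            HM p r = HM b c,
            p < b <= HM b c, HM b c <= c < r &
            HM b c <= r < rstar n c]],
      [/\ b = c, c = p, p = r, 0 < b & q = +oo] |
      [/\ b = p, c = r, 1 <= p, p <= r &
          q^-1 = n%:R%:E / p - n%:R%:E / r]] ->
  exists2 C : R, (0 < C)%R &
    forall f : Rn R n * Rn R n -> R, mixed_Lebesgue b c f ->
      weak_norm (@lebesgue_measure R) q
        (fun t => mixed_norm r p (transport t f))
      <= C%:E * mixed_norm b c f.
Proof.
(* Shared by case (b) and by the diagonal p = r of case (c). *)
have diag (s : \bar R) : 0 < s -> exists2 C : R, (0 < C)%R &
    forall f : Rn R n * Rn R n -> R, mixed_Lebesgue s s f ->
      weak_norm (@lebesgue_measure R) +oo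
        (fun t => mixed_norm s s (transport t f)) <= C%:E * mixed_norm s s f.
  move=> s0; exists 1%R => // f [mf _]; rewrite mul1e /weak_norm.
  apply: Lnorm_y_le; first exact: mixed_norm_ge0.
  apply: aeW => t; rewrite gee0_abs ?mixed_norm_ge0//.
  exact: mixed_norm_transport_diag.
case=> [[q1 p1 r1 [qE HE pb cr rr]]|[-> -> -> b0 ->]|[-> -> p1 pr qE]].
- move: q1 p1 r1 qE HE pb cr rr.
  case: q => [q| |]//; last by rewrite ltxx andbF.
  case: p => [p| |]//; last by rewrite ltxx andbF.
  case: r => [r| |]//; last by rewrite ltxx andbF.
  rewrite !lee_fin lte_fin => /andP[q1 _] /andP[p1 _] /andP[r1 _] qE HE.
  move=> /andP[pb bH] /andP[Hc cr] /andP[_ rr].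
  have bc := le_trans bH Hc.
  case: c HE Hc cr rr bc bH qE => [c| |]//; last first.
    by move=> _ _ _ _ ; case: b pb => // b; rewrite leNgt ltNyr.
  case: b pb => [b| |]// pb HE Hc cr rr bc _ qE.
  rewrite lte_fin in pb; rewrite lte_fin in cr; rewrite lee_fin in bc.
  have p0 : (0 < p)%R by lra.
  have r0 : (0 < r)%R by lra.
  have b0 : (0 < b)%R by lra.
  have c0 : (0 < c)%R by lra.
  have q0 : (0 < q)%R by lra.
  have pc : (p < c)%R by lra.
  have := HM_inj p0 r0 b0 c0 HE => {}HE.
  have := lt_rstar hn c0 rr => {}rr.
  move: qE; rewrite !inverE ?gt_eqF// -!EFinM -EFinD => -[] qE.
  (* Equality of the harmonic means turns n/b - n/r into n/p - n/c, the form that case (c) has from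
     the start. *)
  have qE' : (q^-1 = n%:R / p - n%:R / c)%R.
    have -> : (p^-1 = b^-1 + c^-1 - r^-1)%R by lra.
    lra.
  apply: (weak_norm_transport_le p0 r0 b0 pc q0 hn qE').
  apply: vavg_weak_type_interior => //.
  + by rewrite ltr_pdivlMr// mul1r.
  + by rewrite ler_pM2r// invr_gt0.
  + by rewrite divr_gt0.
  + rewrite !invf_div -[1%R](divff (lt0r_neq0 p0)) -!mulrDr -mulrBr.
    by congr (_ * _)%R; lra.
  + rewrite invf_div.
    (* The condition n (a - 1) < 1 reads n (1 - c/r) < 1 after the harmonic mean relation, which is
       the inequality from [lt_rstar]. *)
    have -> : (c / p * (1 - p / b) = c * (p^-1 - b^-1))%R.
      by field; rewrite !gt_eqF.
    have -> : (p^-1 - b^-1 = c^-1 - r^-1)%R by lra.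
    rewrite mulrBr divff ?gt_eqF// mulrBr mulr1 mulrA ltrBlDl -ltrBlDr.
    by rewrite ltr_pdivlMr//; lra.
- exact: diag.
- have p0 : 0 < p by rewrite (lt_le_trans _ p1).
  (* Case (c) prescribes only the inverse of q; since 0^-1 = +oo, this recovers q also when p =
     r. *)
  have qK : q = (q^-1)^-1 by rewrite inveK.
  have [prE|pr'] := eqVneq p r.
    have q_y : q = +oo.
      rewrite qK qE -prE subee ?inve0//.
      case: p p1 p0 {pr qE prE} => [p _ p0|_ _|//].
        by rewrite inverE// gt_eqF.
      by rewrite invey mule0.
    by rewrite q_y -prE; exact: diag.
  have {pr'}pr : p < r by rewrite lt_neqAle pr'.
  case: p p1 p0 pr qE => [p p1 p0 pr qE|_ _ yr|//]; last first.
    by move: yr; rewrite ltNge leey.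
  rewrite lee_fin in p1; rewrite lte_fin in p0.
  have n0' : (0 < n%:R :> R)%R by rewrite ltr0n.
  case: r pr qE => [r| |]//.
    rewrite lte_fin => pr qE; have r0 : (0 < r)%R by rewrite (lt_trans p0).
    rewrite !inverE ?gt_eqF// -!EFinM -EFinB in qE.
    have qi0 : (0 < n%:R / p - n%:R / r)%R.
      by rewrite subr_gt0 ltr_pM2l// ltf_pV2.
    rewrite qK qE inverE ?gt_eqF//.
    apply: weak_norm_transport_le => //; rewrite ?invr_gt0 ?invrK//.
    rewrite divff ?gt_eqF//; apply: vavg_weak_type_endpoint => //.
    by rewrite ltr_pdivlMr// mul1r.
  (* What remains is r = +oo, where dispersion alone suffices. *)
  move=> _; rewrite invey mule0 sube0 inverE ?gt_eqF// -EFinM => qE.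
  have qi0 : (0 < n%:R / p)%R by rewrite divr_gt0.
  rewrite qK qE inverE ?gt_eqF//.
  by apply: weak_norm_dispersive_y => //; rewrite invrK.
Qed.
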